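(* Let $(X,d,\mu)$ be a reverse doubling space. Given $0<\eta<1$, let $p(\cdot):X\to[1,+\infty)$ be a measurable function such that $p(\cdot)\in LH$ and $1=p_-\leq p_+<1/\eta$. Define $q(\cdot)$ by $1/p(\cdot)-1/q(\cdot)=\eta$. Then there exists $C=C(p(\cdot),\eta,X)$ such that for all $f\in L^{p(\cdot)}(X)$, $$\sup_{t>0}\,t\,\|\chi_{\{x\in X:\,|I_\eta f(x)|>t\}}\|_{q(\cdot)}\leq C\|f\|_{p(\cdot)}.$$ Moreover, if $\mu(X)<+\infty$, the hypothesis $p(\cdot)\in LH$ can be replaced by $1/p(\cdot)\in LH_0$.
   Context: $\chi_E$ is the indicator function of $E$. A quasi-metric space $(X,d)$ is a set $X$ with $d:X\times X\to[0,\infty)$ such that $d(x,y)=0$ iff $x=y$, $d(x,y)=d(y,x)$, and $d(x,y)\le A_0(d(x,z)+d(y,z))$ for all $x,y,z$ and some constant $A_0\ge1$. Write $B(x,r)$ for the ball with center $x$ and radius $r$. $(X,d,\mu)$ is a space of homogeneous type if $(X,d)$ is a quasi-metric space, $\mu$ is a positive measure defined on the $\sigma$-algebra generated by quasi-metric balls and open sets, $0<\mu(B)<\infty$ for every ball $B$, and there is $C_\mu\ge1$ with $\mu(B(x,2r))\le C_\mu\,\mu(B(x,r))$ for all $x\in X$, $r>0$. A reverse doubling space is a space of homogeneous type for which there is a constant $0<\gamma<1$ such that $\mu(B(x,r/2))\le\gamma\,\mu(B(x,r))$ for every $x\in X$ and $r>0$ with $B(x,r)\subsetneq X$. Fractional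 integral operator: for $0<\eta<1$, $$I_\eta f(x)=\int_X\frac{f(y)}{\mu\big(B(x,d(x,y))\big)^{1-\eta}}\,d\mu(y).$$ Variable Lebesgue spaces: for measurable $p(\cdot):X\to[1,\infty]$ let $\Omega_\infty^{p(\cdot)}=\{x\in X:p(x)=\infty\}$ and $$\rho_{p(\cdot)}(f)=\int_{X\setminus\Omega_\infty^{p(\cdot)}}|f(x)|^{p(x)}\,d\mu(x)+\|f\|_{L^\infty(\Omega_\infty^{p(\cdot)})}.$$ $L^{p(\cdot)}(X)$ is the set of measurable $f$ with $\rho_{p(\cdot)}(f/\lambda)<\infty$ for some $\lambda>0$, with norm $\|f\|_{p(\cdot)}=\inf\{\lambda>0:\rho_{p(\cdot)}(f/\lambda)\le1\}$. Put $p_-=\operatorname{ess\,inf}_{x\in X}p(x)$ and $p_+=\operatorname{ess\,sup}_{x\in X}p(x)$. Log-Hölder conditions: for $r(\cdot):X\to[0,\infty)$, $r(\cdot)\in LH_0$ if there is $C_0$ with $|r(x)-r(y)|\le \frac{-C_0}{\log d(x,y)}$ for all $x\neq y$ in $X$ with $d(x,y)<1/2$. $r(\cdot)\in LH_\infty$ (with respect to a base point $x_0\in X$; the choice of base point is immaterial up to changing the constant) if there are constants $C_\infty,r_\infty$ with $|r(x)-r_\infty|\le\frac{C_\infty}{\log(e+d(x,x_0))}$ for all $x\in X$. $LH=LH_0\cap LH_\infty$. *)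

(* Defs.v *)
From HB Require Import structures.
From mathcomp Require Import all_boot all_order all_algebra.
From mathcomp Require Import all_classical all_reals all_analysis.
From mathcomp Require Import ess_sup_inf.

Set Implicit Arguments.
Unset Strict Implicit.
Unset Printing Implicit Defensive.

Import Order.TTheory GRing.Theory Num.Theory.
Import numFieldNormedType.Exports.

Local Open Scope classical_set_scope.
Local Open Scope ring_scope.

Definition quasi_metric (R : realType) (X : Type) (dist : X -> X -> R) : Prop :=
  [/\ forall x y, 0 <= dist x y,
      forall x y, dist x y = 0 <-> x = y,
      forall x y, dist x y = dist y x &
      exists2 A0 : R, 1 <= A0 &
        forall x y z, dist x y <= A0 * (dist x z + dist y z)].

Definition qball (R : realType) (X : Type) (dist : X -> X -> R) (x : X) (r : R)
  : set X := [set y | dist x y < r].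

Definition qopen (R : realType) (X : Type) (dist : X -> X -> R) (U : set X)
  : Prop := forall x, U x -> exists2 r : R, 0 < r & qball dist x r `<=` U.

(* Quasi-metric balls need not be open, so they are listed as generators. *)
Definition balls_and_opens (R : realType) (X : Type) (dist : X -> X -> R)
  : set (set X) :=
  [set A | (exists x r, 0 < r /\ A = qball dist x r) \/ qopen dist A].

Definition homogeneous_type (R : realType) (d : measure_display)
    (X : measurableType d) (dist : X -> X -> R)
    (mu : {measure set X -> \bar R}) : Prop :=
  [/\ quasi_metric dist,
      (measurable : set (set X)) = <<s balls_and_opens dist >>,
      forall x r, 0 < r -> (0 < mu (qball dist x r) < +oo)%E &
      exists2 Cmu : R, 1 <= Cmu &
        forall x r, 0 < r ->
          (mu (qball dist x (2 * r)) <= Cmu%:E * mu (qball dist x r))%E].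

Definition reverse_doubling (R : realType) (d : measure_display)
    (X : measurableType d) (dist : X -> X -> R)
    (mu : {measure set X -> \bar R}) : Prop :=
  homogeneous_type dist mu /\
  exists2 gamma : R, 0 < gamma < 1 &
    forall x r, 0 < r -> qball dist x r `<` setT ->
      (mu (qball dist x (r / 2)) <= gamma%:E * mu (qball dist x r))%E.

(* On the diagonal the ball is empty and, since 0^-1 = 0, the kernel is 0.
   In a reverse doubling space with at least two points, points are null sets,
   so this does not affect the integral; in a one-point space it is a choice. *)
Definition frac_integral (R : realType) (d : measure_display)
    (X : measurableType d) (dist : X -> X -> R)
    (mu : {measure set X -> \bar R}) (eta : R) (f : X -> R) (x : X) : \bar R :=
  (\int[mu]_y (f y / (fine (mu (qball dist x (dist x y)))) `^ (1 - eta))%:E)%E.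

Definition exponent_infty (R : realType) (X : Type) (p : X -> \bar R) : set X :=
  [set x | p x = +oo%E].

Definition modular (R : realType) (d : measure_display) (X : measurableType d)
    (mu : {measure set X -> \bar R}) (p : X -> \bar R) (f : X -> R) : \bar R :=
  (\int[mu]_(x in ~` exponent_infty p) (`|f x| `^ fine (p x))%:E +
   Lnorm mu +oo (EFin \o (f \_ (exponent_infty p))))%E.

Definition var_Lebesgue (R : realType) (d : measure_display)
    (X : measurableType d) (mu : {measure set X -> \bar R}) (p : X -> \bar R)
  : set (X -> R) :=
  [set f : X -> R | measurable_fun setT f /\
    exists2 l : R, 0 < l & (modular mu p (fun x => (f x / l)%R) < +oo)%E].

Definition var_norm (R : realType) (d : measure_display) (X : measurableType d)
    (mu : {measure set X -> \bar R}) (p : X -> \bar R) (f : X -> R) : \bar R :=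
  ereal_inf [set l%:E | l in
    [set l : R | 0 < l /\ (modular mu p (fun x => (f x / l)%R) <= 1)%E]].

Definition LH0 (R : realType) (X : Type) (dist : X -> X -> R) (r : X -> R)
  : Prop :=
  exists C0 : R, forall x y, x <> y -> dist x y < 1 / 2 ->
    `|r x - r y| <= - C0 / ln (dist x y).

Definition LH_infty (R : realType) (X : Type) (dist : X -> X -> R) (x0 : X)
    (r : X -> R) : Prop :=
  exists Cinf rinf : R, forall x,
    `|r x - rinf| <= Cinf / ln (expR 1 + dist x x0).

Definition LH (R : realType) (X : Type) (dist : X -> X -> R) (x0 : X)
    (r : X -> R) : Prop :=
  LH0 dist r /\ LH_infty dist x0 r.

Definition weak_var_norm (R : realType) (d : measure_display)
    (X : measurableType d) (mu : {measure set X -> \bar R}) (q : X -> \bar R)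
    (g : X -> \bar R) : \bar R :=
  ereal_sup [set (t%:E * var_norm mu q (\1_[set x | (t%:E < `|g x|)%E]))%E
            | t in [set t : R | 0 < t]].

(* Main.v *)
Require Import Defs.
From HB Require Import structures.
From mathcomp Require Import all_boot all_order all_algebra.
From mathcomp Require Import all_classical all_reals all_analysis.
From mathcomp Require Import ess_sup_inf measurable_realfun lra ring.

(* Normalise f >= 0 so that the modular of f is at most 1, and write V(x, r) for
   the measure of B(x, r), u = 1/p, 1/q = u - eta.
   (1) Cutting the kernel along dyadic levels of V(x, d(x, y)) at the level
   s ~ t^(-q(x)), a Hedberg-type splitting shows that I f(x) > t forces some ball
   B centred at x to satisfy avg_B f >= c t^(q(x)/p(x)), provided
   int_B f <= K V(B)^(1 - u(x)) for all balls B centred at x.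
   (2) On a ball, log-Hoelder continuity makes V(B)^(u(x) - u(y)) bounded, and
   f <= s + f^p(y) s^(1 - p(y)) then turns this into
   t^q(x) V(B) <= C int_B f^p(.). A Vitali selection by measure concludes.
   (3) This is run on f 1_{f > 1} with the exponent p(.) when t is large; when t
   is small, on f 1_{f > 1} with the exponent 1 and on f 1_{f <= 1} with the
   limit exponent at infinity, the decay condition at infinity turning
   t^q(x) into t^q(oo) up to an integrable error. *)

Set Implicit Arguments.
Unset Strict Implicit.
Unset Printing Implicit Defensive.

Import Order.TTheory GRing.Theory Num.Theory.
Import numFieldNormedType.Exports.

Local Open Scope classical_set_scope.
Local Open Scope ring_scope.

(** Measurability of the potential and of its level sets is never established, so every bound is a
    bound on an upper integral, and a level set is the set where such a bound fails. As p may take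
    the value 1, the maximal function is only of weak type and cannot be bounded in norm; the
    covering is therefore applied directly to balls with the variable level t^q(x). The exponents
    match because q/p = u/(u - eta): an average of size t^(q/p), raised to the power p, is t^q. The
    obstacle is that log-Hoelder continuity controls V(B)^(u(x) - u(y)) only on balls of small
    measure; on large ones the exponent cannot be frozen. Hence the cut at f = 1. Where f > 1 one
    has f <= f^p, so the integral is at most 1 and large balls satisfy the growth condition at once.
    Where f <= 1 all averages are at most 1, which excludes large t, and the exponent may be
    replaced by a constant one. Working with u = 1/p unifies the two hypotheses: if the measure is
    finite, reverse doubling makes X bounded, and the condition at infinity for 1/p is automatic. *)

(** * Upper integrals of nonmeasurable functions *)

Section UpperIntegral.
Context (R : realType) (d : measure_display) (X : measurableType d).
Variable mu : {measure set X -> \bar R}.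
Implicit Types (h : X -> R) (G : X -> \bar R) (c : R).

(** The integral of a nonnegative function is a supremum over the simple functions below it, so
    monotonicity holds for nonmeasurable integrands as well. *)
Lemma ge0_le_lower_integral (f g : X -> \bar R) :
  (forall x, 0 <= f x)%E -> (forall x, f x <= g x)%E ->
  (\int[mu]_x f x <= \int[mu]_x g x)%E.
Proof.
move=> f0 fg.
have g0 x : (0 <= g x)%E by exact: le_trans (f0 x) (fg x).
rewrite !ge0_integralTE//; apply: ereal_sup_le => _ [h /= hf <-].
by exists h => // x; exact: le_trans (hf x) (fg x).
Qed.

(* The upper integral of [h] is at most [c]; unlike the library's integral, a
   supremum over simple functions below, it is subadditive on nonmeasurable
   functions. *)
Definition upper_integral_le h c :=
  exists G : X -> \bar R, [/\ measurable_fun setT G, (forall y, 0 <= G y)%E,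
    (forall y, (h y)%:E <= G y)%E & (\int[mu]_y G y <= c%:E)%E].

Lemma upper_integral_le_measurable h c : measurable_fun setT h ->
  (forall y, 0 <= h y) -> (\int[mu]_y (h y)%:E <= c%:E)%E ->
  upper_integral_le h c.
Proof.
move=> mh h0 hc; exists (EFin \o h); split => //.
by apply/measurable_EFinP.
Qed.

Lemma upper_integral_leS h h' c c' : (forall y, h y <= h' y) -> c' <= c ->
  upper_integral_le h' c' -> upper_integral_le h c.
Proof.
move=> hh' c'c [G [mG G0 hG Gc]]; exists G; split => //.
  by move=> y; apply: le_trans (hG y); rewrite lee_fin.
by apply: le_trans Gc _; rewrite lee_fin.
Qed.

Lemma upper_integral_leD h h' c c' :
  upper_integral_le h c -> upper_integral_le h' c' ->
  upper_integral_le (fun y => h y + h' y) (c + c').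
Proof.
move=> [G [mG G0 hG Gc]] [G' [mG' G'0 hG' G'c]].
exists (fun y => G y + G' y)%E; split => //.
- exact: emeasurable_funD.
- by move=> y; apply: adde_ge0.
- by move=> y; rewrite EFinD; apply: leeD.
- by rewrite ge0_integralD// EFinD leeD.
Qed.

Lemma upper_integral_leZ h c k : 0 <= k ->
  upper_integral_le h c -> upper_integral_le (fun y => k * h y) (k * c).
Proof.
move=> k0 [G [mG G0 hG Gc]]; exists (fun y => k%:E * G y)%E; split => //.
- exact: measurable_funeM.
- by move=> y; apply: mule_ge0; rewrite ?lee_fin.
- by move=> y; rewrite EFinM lee_wpmul2l// lee_fin.
- by rewrite ge0_integralZl_EFin// EFinM lee_wpmul2l// lee_fin.
Qed.

(** The majorant is the series of the [h n], which dominates each of its terms and can be integrated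
    term by term. *)
Lemma upper_integral_le_sup (h : nat -> X -> R) (a : nat -> R) h' c :
  (forall n, measurable_fun setT (h n)) -> (forall n y, 0 <= h n y) ->
  (forall n, (\int[mu]_y (h n y)%:E <= (a n)%:E)%E) ->
  (forall N, \sum_(i < N) a i <= c) ->
  (forall y, h' y <= 0 \/ exists n, h' y <= h n y) ->
  upper_integral_le h' c.
Proof.
move=> mh h0 ha ac hh'.
exists (fun y => \sum_(n <oo) (h n y)%:E)%E; split => //.
- by apply: ge0_emeasurable_sum => [n x _ _|n _]; rewrite ?lee_fin//;
    exact/measurable_EFinP.
- by move=> y; apply: nneseries_ge0 => n _ _; rewrite lee_fin.
- move=> y; have [hy|[n hn]] := hh' y.
    apply: (@le_trans _ _ 0%E); first by rewrite lee_fin.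
    by apply: nneseries_ge0 => n _ _; rewrite lee_fin.
  apply: le_trans (nneseries_lim_ge n.+1 _); last first.
    by move=> k _; rewrite lee_fin.
  rewrite sumEFin lee_fin big_mkord big_ord_recr/=.
  by rewrite (le_trans hn)// lerDr sumr_ge0.
- rewrite integral_nneseries//; last 2 first.
  + by move=> n; exact/measurable_EFinP.
  + by move=> n x _; rewrite lee_fin.
  apply: lime_le.
    by apply: is_cvg_nneseries => n _ _; apply: integral_ge0 => x _; rewrite lee_fin.
  near=> n; rewrite big_mkord.
  apply: (@le_trans _ _ (\sum_(i < n) (a i)%:E)%E); first exact: lee_sum.
  by rewrite sumEFin lee_fin.
Unshelve. all: by end_near. Qed.

(** Returns to the library's integral of a signed function: its positive and negative parts both
    have integral in [0, c], so their difference is defined and at most c in absolute value. *)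
Lemma upper_integral_le_abse h h' c : (forall y, `|h y| <= h' y) ->
  upper_integral_le h' c -> (`|\int[mu]_y (h y)%:E| <= c%:E)%E.
Proof.
move=> hh' [G [mG G0 hG Gc]]; rewrite integralE.
have bnd (f : X -> \bar R) : (forall y, 0 <= f y)%E ->
    (forall y, f y <= `|(h y)%:E|)%E -> (0 <= \int[mu]_y f y <= c%:E)%E.
  move=> f0 fh; rewrite integral_ge0//=; apply: le_trans Gc.
  apply: ge0_le_lower_integral => // y; apply: le_trans (fh y) _.
  by apply: le_trans (hG y); rewrite /= lee_fin.
have := bnd _ (fun y => funepos_ge0 (EFin \o h) y).
have := bnd _ (fun y => funeneg_ge0 (EFin \o h) y).
move=> /(_ _)/andP[|n0 nc].
  by move=> y; rewrite funenegE/= ge_max; apply/andP; split; rewrite ?lee_fin// -normrN ler_norm.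
move=> /(_ _)/andP[|p0 pc].
  by move=> y; rewrite funeposE/= ge_max; apply/andP; split; rewrite ?lee_fin// ler_norm.
have key (a b : \bar R) : (0 <= a)%E -> (a <= c%:E)%E -> (0 <= b)%E ->
    (b <= c%:E)%E -> (`|a - b| <= c%:E)%E.
  case: a => [a| |]//; case: b => [b| |]//; rewrite -EFinB /= !lee_fin.
  by move=> *; rewrite ler_norml; apply/andP; split; lra.
exact: key.
Qed.

End UpperIntegral.

(** * Volumes of balls under doubling and reverse doubling *)

Record reverse_doubling_with (R : realType) (d : measure_display)
    (X : measurableType d) (dist : X -> X -> R) (mu : {measure set X -> \bar R})
    (A0 Cmu gamma : R) : Prop := ReverseDoublingWith {
  rd_dist_ge0 : forall x y, 0 <= dist x y;
  rd_dist_eq0 : forall x y, dist x y = 0 <-> x = y;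
  rd_distC : forall x y, dist x y = dist y x;
  rd_A0_ge1 : 1 <= A0;
  rd_dist_triangle : forall x y z, dist x y <= A0 * (dist x z + dist y z);
  rd_measurable_ball : forall x r, measurable (qball dist x r);
  rd_ball_gt0 : forall x r, 0 < r -> (0 < mu (qball dist x r) < +oo)%E;
  rd_Cmu_ge1 : 1 <= Cmu;
  rd_doubling : forall x r, 0 < r ->
    (mu (qball dist x (2 * r)) <= Cmu%:E * mu (qball dist x r))%E;
  rd_gamma : 0 < gamma < 1;
  rd_reverse : forall x r, 0 < r -> qball dist x r `<` setT ->
    (mu (qball dist x (r / 2)) <= gamma%:E * mu (qball dist x r))%E }.

Definition ball_volume (R : realType) (d : measure_display)
    (X : measurableType d) (dist : X -> X -> R) (mu : {measure set X -> \bar R})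
    (x : X) (r : R) : R := fine (mu (qball dist x r)).

Section Geometry.
Context (R : realType) (d : measure_display) (X : measurableType d).
Variables (dist : X -> X -> R) (mu : {measure set X -> \bar R}).

Lemma qball_le0 x r : (forall x y, 0 <= dist x y) -> r <= 0 ->
  qball dist x r = set0.
Proof.
move=> dist0 r0; rewrite -subset0 => y /=; rewrite /qball/=.
by apply/negP; rewrite -leNgt (le_trans r0).
Qed.

(** Fixes the three constants, so that later bounds may depend on them; the generated sigma-algebra
    enters only through the measurability of balls. *)
Lemma reverse_doubling_constants : reverse_doubling dist mu ->
  exists A0 Cmu gamma, reverse_doubling_with dist mu A0 Cmu gamma.
Proof.
move=> [[[d0 deq dC [A0 A01 dtri]] mE mub [Cmu C1 dbl]] [gamma g01 rd]].
exists A0, Cmu, gamma; split => // x r.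
have [r0|r0] := ltP 0 r; last by rewrite qball_le0.
by rewrite mE; apply: sub_sigma_algebra; left; exists x, r.
Qed.

Variables (A0 Cmu gamma : R).
Hypothesis rd : reverse_doubling_with dist mu A0 Cmu gamma.

Let B := qball dist.
Let V := ball_volume dist mu.
Let dist0 := rd_dist_ge0 rd.

Lemma ball_volumeE x r : mu (qball dist x r) = (ball_volume dist mu x r)%:E.
Proof.
rewrite /ball_volume fineK//; have [r0|r0] := ltP 0 r; last by rewrite qball_le0 ?measure0.
have /andP[m0 moo] := rd_ball_gt0 rd x r0.
by rewrite fin_numE gt_eqF ?(lt_trans _ m0)//= lt_eqF.
Qed.

Lemma ball_volume_ge0 x r : 0 <= V x r.
Proof. exact: fine_ge0. Qed.

Lemma ball_volume_gt0 x r : 0 < r -> 0 < V x r.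
Proof.
by move=> /(rd_ball_gt0 rd x)/andP[]; rewrite ball_volumeE lte_fin.
Qed.

Lemma subset_ball_volume x y r s : B x r `<=` B y s -> V x r <= V y s.
Proof.
move=> sub; rewrite -lee_fin -!ball_volumeE; apply: le_measure => //;
  by rewrite inE; apply: (rd_measurable_ball rd).
Qed.

Lemma le_ball_volume x r s : r <= s -> V x r <= V x s.
Proof.
by move=> rs; apply: subset_ball_volume => y; rewrite /B/qball/= => /lt_le_trans h; exact: h.
Qed.

Lemma ball_volume_doubling n x r s : 0 < r -> s <= 2 ^+ n * r ->
  V x s <= Cmu ^+ n * V x r.
Proof.
move=> r0; move=> /(le_ball_volume x)/le_trans; apply.
elim: n => [|n IH]; first by rewrite !expr0 !mul1r.
rewrite exprS -mulrA; apply: (@le_trans _ _ (Cmu * V x (2 ^+ n * r))).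
  rewrite -lee_fin EFinM -!ball_volumeE; apply: (rd_doubling rd).
  by rewrite mulr_gt0// exprn_gt0.
by rewrite exprS -mulrA ler_pM2l// (lt_le_trans ltr01 (rd_Cmu_ge1 rd)).
Qed.

Lemma ball_volume_reverse n x r : 0 < r -> B x (2 ^+ n * r) <> setT ->
  V x r <= gamma ^+ n * V x (2 ^+ n * r).
Proof.
have /andP[g0 g1] := rd_gamma rd.
move=> r0; elim: n => [|n IH] nT; first by rewrite !expr0 !mul1r.
have lt0 : 0 < 2 ^+ n * r by rewrite mulr_gt0// exprn_gt0.
have nT' : B x (2 ^+ n * r) <> setT.
  move=> BT; apply: nT; rewrite -subTset -BT => y /= /lt_le_trans; apply.
  by rewrite exprS -mulrA ler_peMl// ?ler1n ?ltW.
apply: (le_trans (IH nT')); rewrite exprSr -mulrA ler_pM2l ?exprn_gt0//.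
have := rd_reverse rd (x := x) (r := 2 ^+ n.+1 * r).
rewrite -/B !ball_volumeE -EFinM lee_fin -/V.
have -> : 2 ^+ n.+1 * r / 2 = 2 ^+ n * r by rewrite exprS; field.
apply; first by rewrite mulr_gt0// exprn_gt0.
by rewrite properEneq; split => //; apply/eqP.
Qed.

(** As long as the dyadic balls are proper, V(x, 1) <= gamma^n V(x, 2^n), so the volumes grow
    geometrically. *)
Lemma ball_volume_unbounded x M : (forall n, B x (2 ^+ n) <> setT) ->
  exists n, M < V x (2 ^+ n).
Proof.
have /andP[g0 g1] := rd_gamma rd.
move=> nT; have V1 : 0 < V x 1 by apply: ball_volume_gt0.
have [M0|M0] := leP M 0.
  by exists 0%N; rewrite expr0 (le_lt_trans M0).
have [n /= hn] : exists n, gamma ^+ n < V x 1 / M.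
  have := @cvg_expr _ gamma; rewrite ger0_norm ?ltW// => /(_ g1)/cvgrPdist_lt.
  move=> /(_ (V x 1 / M)); rewrite divr_gt0// => /(_ isT)[n _ /(_ n (leqnn n))].
  by rewrite sub0r normrN ger0_norm ?exprn_ge0 ?ltW//; exists n.
exists n; have := @ball_volume_reverse n x 1 ltr01; rewrite mulr1 => /(_ (nT n)).
move=> h; rewrite -(ltr_pM2l (exprn_gt0 n g0)); apply: lt_le_trans h.
by rewrite -ltr_pdivlMr.
Qed.

(** Volumes cannot grow without bound, so some dyadic ball is the whole space. *)
Lemma finite_measure_bounded : (mu setT < +oo)%E ->
  exists2 D, 0 <= D & forall x y, dist x y <= D.
Proof.
move=> muoo.
have [[x0 _]|nE] := pselect (exists x : X, True); last first.
  by exists 0 => // x; exfalso; apply: nE; exists x.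
have [[n BT]|h] := pselect (exists n, B x0 (2 ^+ n) = setT).
  exists (A0 * (2 ^+ n + 2 ^+ n)).
    by rewrite mulr_ge0 ?addr_ge0 ?exprn_ge0// (le_trans ler01 (rd_A0_ge1 rd)).
  move=> x y; apply: le_trans (rd_dist_triangle rd x y x0) _.
  rewrite ler_wpM2l ?(le_trans ler01 (rd_A0_ge1 rd))//.
  have hB z : dist z x0 <= 2 ^+ n.
    by rewrite (rd_distC rd) ltW//; have : setT z by []; rewrite -BT.
  exact: lerD.
have nT n : B x0 (2 ^+ n) <> setT by move=> BT; apply: h; exists n.
have [n] := ball_volume_unbounded (fine (mu setT)) nT.
rewrite ltNge => /negP[]; rewrite -lee_fin -ball_volumeE fineK.
  by apply: le_measure => //; rewrite inE//; exact: (rd_measurable_ball rd).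
by rewrite ge0_fin_numE.
Qed.

(** Encloses a sublevel set of V(x, d(x, .)) in one ball of comparable volume. The radius is twice a
    distance that exceeds half the supremum over the set, so a single doubling suffices. The centre
    is left out because the radius may be 0. *)
Lemma small_volume_ball x s : 0 < s -> exists2 r, V x r <= Cmu * s &
  forall y, y <> x -> V x (dist x y) < s -> dist x y < r.
Proof.
move=> s0; pose T := [set dist x y | y in [set y | y <> x /\ V x (dist x y) < s]].
have C0 : 0 < Cmu by rewrite (lt_le_trans ltr01 (rd_Cmu_ge1 rd)).
have [T0|/set0P[_ [y0 [y0x Vy0] _]]] := eqVneq T set0.
  exists 0; first by rewrite /V/ball_volume qball_le0// measure0 mulr_ge0// ltW.
  move=> y yx Vy; have : T (dist x y) by exists y.
  by rewrite T0.
have y0T : T (dist x y0) by exists y0.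
have supT : has_sup T.
  split; first by exists (dist x y0).
  have [[n BT]|h] := pselect (exists n, B x (2 ^+ n) = setT).
    exists (2 ^+ n) => _ [y _ <-]; rewrite ltW//.
    by have : setT y by []; rewrite -BT.
  have nT n : B x (2 ^+ n) <> setT by move=> BT; apply: h; exists n.
  have [n sn] := ball_volume_unbounded s nT.
  exists (2 ^+ n) => _ [y [_ Vy] <-]; rewrite leNgt; apply/negP => /ltW ny.
  by have := lt_trans sn (le_lt_trans (le_ball_volume x ny) Vy); rewrite ltxx.
have dpos y : y <> x -> 0 < dist x y.
  move=> yx; rewrite lt_neqAle dist0 andbT eq_sym; apply/eqP => /(rd_dist_eq0 rd).
  by move=> xy; apply: yx.
have ubT := sup_upper_bound supT.
have rho0 : 0 < sup T by apply: lt_le_trans (ubT _ y0T); exact: dpos.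
have [|_ [y [yx Vy] <-] hy] := @sup_adherent _ T (sup T / 2) _ supT.
  exact: divr_gt0.
exists (2 * dist x y).
  apply: (@le_trans _ _ (Cmu ^+ 1 * V x (dist x y))).
    by apply: ball_volume_doubling; rewrite ?expr1// dpos.
  by rewrite expr1 ler_pM2l// ltW.
move=> z zx Vz; apply: (@le_lt_trans _ _ (sup T)).
  by apply: ubT; exists z.
by move: hy; lra.
Qed.

End Geometry.

Lemma exp2_ge (R : realType) (a : R) : exists n, a <= 2 ^+ n.
Proof.
exists (Num.truncn a).+1; apply/ltW; apply: lt_le_trans (truncnS_gt a) _.
by rewrite -natrX ler_nat ltnW// ltn_expl.
Qed.

(** * Greedy selection of disjoint sets by size *)

Section GreedySelection.
Context (R : realType) (T X : Type).
Variables (E : set T) (B : T -> set X) (m : T -> R) (M : R).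
Hypothesis mE : forall x, E x -> 0 < m x <= M.

Let avail (U : set T) := [set y | E y /\ forall x, U x -> B x `&` B y = set0].

Let near_max (U : set T) (x : T) :=
  avail U x /\ forall y, avail U y -> m y <= 2 * m x.

Let near_max_exists U y : avail U y -> exists x, near_max U x.
Proof.
move=> Uy; pose S := [set m x | x in avail U].
have supS : has_sup S.
  split; first by exists (m y), y.
  by exists M => _ [x [Ex _] <-]; have /andP[] := mE Ex.
have ubS := sup_upper_bound supS.
have S0 : 0 < sup S.
  apply: (@lt_le_trans _ _ (m y)); first by have /andP[] := mE Uy.1.
  by apply: ubS; exists y.
have [|_ [x Ux <-] hx] := @sup_adherent _ S (sup S / 2) _ supS.
  exact: divr_gt0.
exists x; split => // z Uz; apply: (@le_trans _ _ (sup S)).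
  by apply: ubS; exists z.
by move: hx; lra.
Qed.

(** By [near_max_exists], [None] means that no available set is left. *)
Let pick U : option T := if pselect (exists x, near_max U x) is left h
  then Some (projT1 (cid h)) else None.

Let pickP U x : pick U = Some x -> near_max U x.
Proof. by rewrite /pick; case: pselect => // h [<-]; case: cid. Qed.

Let used (n : nat) : set T :=
  iter n (fun U => U `|` [set x | pick U = Some x]) set0.

Let usedP n x : used n x <-> exists2 i, (i < n)%N & pick (used i) = Some x.
Proof.
elim: n => [|n IH]; first by split => // -[].
split => [[/IH[i lt_in hi]|hx]|[i]].
- by exists i => //; rewrite ltnS ltnW.
- by exists n.
- rewrite ltnS leq_eqVlt => /predU1P[->|lt_in hi]; first by right.
  by left; apply/IH; exists i.
Qed.

(* Either the set [B y] meets a selected set of comparable size, or it stays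
   available at every step, so that the selected sizes do not tend to [0]. *)
Lemma greedy_selection : exists s : nat -> option T, [/\
  forall n x, s n = Some x -> E x,
  forall i j x y, (i < j)%N -> s i = Some x -> s j = Some y ->
    B x `&` B y = set0 &
  forall y, E y ->
    (exists n x, [/\ s n = Some x, B x `&` B y !=set0 & m y <= 2 * m x]) \/
    (forall n, exists2 x, s n = Some x & m y <= 2 * m x)].
Proof.
exists (fun n => pick (used n)); split.
- by move=> n x /pickP[[]].
- move=> i j x y ij si /pickP[[_ h] _]; apply: h.
  by apply/usedP; exists i.
- move=> y Ey; have [h|h] := pselect (forall n, avail (used n) y).
    right => n; have [x nx] := near_max_exists (h n).
    rewrite /pick; case: pselect => [h'|[]]; last by exists x.
    by exists (projT1 (cid h')) => //; case: cid => z [/= _]; apply.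
  left; have {}h : exists n, ~~ `[< avail (used n) y >].
    by move/existsNP : h => [n hn]; exists n; apply/asboolP.
  (* At the last step where [y] is still available it competes with the point picked, which gives
     the size comparison; since it is lost right after, its set meets the picked one. *)
  case: (ex_minnP h) => -[|k] /asboolP nk kmin.
    by exfalso; apply: nk; split.
  have ak : avail (used k) y.
    apply: contrapT => nak; have := kmin k; rewrite ltnn => /(_ _)/notF[].
    exact/asboolP.
  have [x [Ux Bxy]] : exists x, used k.+1 x /\ B x `&` B y <> set0.
    apply: contrapT => hn; apply: nk; split => // x Ux; apply: contrapT => Bxy.
    by apply: hn; exists x.
  have pk : pick (used k) = Some x.
    by case: Ux => // Ux; exfalso; apply: Bxy; apply: ak.2.
  exists k, x; split => //; first by apply/set0P/eqP.
  by have [_] := pickP pk; apply.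
Qed.

End GreedySelection.

(** * Covering by balls selected according to measure *)

Section Vitali.
Context (R : realType) (d : measure_display) (X : measurableType d).
Variables (dist : X -> X -> R) (mu : {measure set X -> \bar R}).
Variables (A0 Cmu gamma : R).
Hypothesis rd : reverse_doubling_with dist mu A0 Cmu gamma.

Let B := qball dist.
Let V := ball_volume dist mu.
Let A00 : 0 < A0 := lt_le_trans ltr01 (rd_A0_ge1 rd).
Let C0 : 0 < Cmu := lt_le_trans ltr01 (rd_Cmu_ge1 rd).

(* The radii are not comparable a priori: reverse doubling turns the comparison
   of measures into one of radii. *)
Lemma engulfing : exists L, forall x y r s, 0 < r -> 0 < s ->
  B x r `&` B y s !=set0 -> V y s <= 2 * V x r -> B y s `<=` B x (2 ^+ L * r).
Proof.
have /andP[g0 g1] := rd_gamma rd.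
have [n1 hn1] := exp2_ge (A0 * (2 * A0 + 1)).
(* Over [l] dyadic steps reverse doubling beats both the factor 2 of the selection and the doubling
   cost [Cmu ^+ n1] of the inclusion [sub]. *)
have [l hl] : exists l, gamma ^+ l * (2 * Cmu ^+ n1) < 1.
  have := @cvg_expr _ gamma; rewrite ger0_norm ?ltW// => /(_ g1)/cvgrPdist_lt.
  move=> /(_ (2 * Cmu ^+ n1)^-1); rewrite invr_gt0 mulr_gt0 ?exprn_gt0// => /(_ isT).
  move=> [n _ /(_ n (leqnn n))].
  rewrite sub0r normrN ger0_norm ?exprn_ge0 ?ltW// => h; exists n.
  by rewrite -ltr_pdivlMr ?mulr_gt0 ?exprn_gt0// div1r.
have [L0 hL0] := exp2_ge (A0 * (1 + A0 * (2 ^+ l + 2 ^+ l))).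
exists (maxn L0 l) => x y r s r0 s0 [z [xz yz]] Vle.
have [BT w yw|BT] := pselect (B x (2 ^+ l * r) = setT).
  have : setT w by []; rewrite -BT => /lt_le_trans; apply.
  by rewrite ler_pM2r// ler_eXn2l ?ltr1n// leq_maxr.
have [sr|rs] := leP s (2 ^+ l * r).
  move=> w yw; rewrite /B/qball/=.
  apply: (@lt_le_trans _ _ (A0 * (1 + A0 * (2 ^+ l + 2 ^+ l)) * r)); last first.
    rewrite ler_pM2r//; apply: le_trans hL0 _.
    by rewrite ler_eXn2l ?ltr1n// leq_maxl.
  apply: (le_lt_trans (rd_dist_triangle rd x w z)).
  rewrite -mulrA ltr_pM2l// mulrDl mul1r ltrD//.
  apply: (le_lt_trans (rd_dist_triangle rd w z y)).
  rewrite -mulrA ltr_pM2l// mulrDl.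
  by apply: ltrD; rewrite (rd_distC rd); apply: lt_le_trans sr.
(* If s > 2^l r, then B(x, 2^l r) lies in a fixed multiple of B(y, s), whence V(x, r) <= gamma^l
   Cmu^n1 V(y, s) < V(x, r). *)
exfalso; have := ball_volume_reverse rd r0 BT; apply/negP; rewrite -ltNge.
have sub : B x (2 ^+ l * r) `<=` B y (A0 * (2 * A0 + 1) * s).
  move=> w xw; rewrite /B/qball/=.
  apply: (le_lt_trans (rd_dist_triangle rd y w x)).
  rewrite -mulrA ltr_pM2l// mulrDl mul1r; apply: ltrD; last first.
    by rewrite (rd_distC rd); exact: lt_trans rs.
  apply: (le_lt_trans (rd_dist_triangle rd y x z)).
  rewrite (mulrC 2) -mulrA ltr_pM2l// mulr_natl mulr2n ltrD//.
  apply: lt_trans xz (le_lt_trans _ rs).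
  by rewrite ler_peMl ?exprn_ege1 ?ler1n// ltW.
apply: (@le_lt_trans _ _ (gamma ^+ l * (Cmu ^+ n1 * V y s))).
  rewrite ler_pM2l ?exprn_gt0//; apply: le_trans (subset_ball_volume rd sub) _.
  by apply: (ball_volume_doubling rd) => //; rewrite ler_pM2r.
apply: (@le_lt_trans _ _ (gamma ^+ l * (Cmu ^+ n1 * (2 * V x r)))).
  by rewrite ler_pM2l ?exprn_gt0// ler_pM2l ?exprn_gt0//.
rewrite (_ : _ * _ = (gamma ^+ l * (2 * Cmu ^+ n1)) * V x r); last by ring.
by rewrite -[ltRHS]mul1r ltr_pM2r// (ball_volume_gt0 rd).
Qed.

End Vitali.

Section VitaliWeakType.
Context (R : realType) (d : measure_display) (X : measurableType d).
Variables (dist : X -> X -> R) (mu : {measure set X -> \bar R}).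
Variables (A0 Cmu gamma : R).
Hypothesis rd : reverse_doubling_with dist mu A0 Cmu gamma.

Let B := qball dist.
Let V := ball_volume dist mu.

Lemma sum_integral_disjoint_le (D : nat -> set X) (g : X -> R) M N :
  (forall n, measurable (D n)) -> trivIset setT D ->
  measurable_fun setT g -> (forall y, 0 <= g y) ->
  (\int[mu]_y (g y)%:E <= M%:E)%E ->
  (\sum_(i < N) \int[mu]_(y in D i) (g y)%:E <= M%:E)%E.
Proof.
move=> mD tD mg g0 gM; apply: le_trans gM.
have mg' A : measurable_fun A (EFin \o g).
  by apply: measurable_funTS; exact/measurable_EFinP.
apply: (@le_trans _ _ (\sum_(i <oo) \int[mu]_(y in D i) (g y)%:E)%E).
  rewrite -(big_mkord xpredT (fun i => \int[mu]_(y in D i) (g y)%:E)%E).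
  by apply: nneseries_lim_ge => k _ _; apply: integral_ge0 => y _; rewrite lee_fin.
rewrite -ge0_integral_bigcup//; last by move=> x _; rewrite lee_fin.
apply: ge0_subset_integral => //; first exact: bigcup_measurable.
by move=> x _; rewrite lee_fin.
Qed.

(** A weak-type estimate with variable level [tau]. The selected balls carry disjoint mass of [g],
    so their [tau V] sum to at most M, and their enlargements cover [E]; the last hypothesis carries
    [tau] from a centre to the points of its enlarged ball. The lower bound [t0] bounds the volumes
    of candidate balls and rules out an endless selection of comparable balls. *)
Lemma vitali_weak_type : exists2 A, 1 <= A & forall (M K t0 : R) (E : set X)
    (g tau : X -> R), 0 <= M -> 1 <= K -> 0 < t0 ->
  measurable_fun setT g -> (forall y, 0 <= g y) ->
  (\int[mu]_y (g y)%:E <= M%:E)%E ->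
  (forall x, E x -> t0 <= tau x) ->
  (forall x, E x -> exists2 r, 0 < r &
    ((tau x * V x r)%:E <= \int[mu]_(y in B x r) (g y)%:E)%E) ->
  (forall x y r, E x -> E y -> 0 < r -> B x r y -> tau x * V x r <= A * M ->
    tau y <= K * tau x) ->
  upper_integral_le mu (fun x => \1_E x * tau x) (K * (A * M)).
Proof.
have [L eng] := engulfing rd.
exists (Cmu ^+ L); first by rewrite exprn_ege1// (rd_Cmu_ge1 rd).
move=> M K t0 E g tau M0 K1 t00 mg g0 gM tE cE slow.
have K0 : 0 < K by rewrite (lt_le_trans ltr01).
have A0' : 0 < Cmu ^+ L by rewrite exprn_gt0// (lt_le_trans ltr01 (rd_Cmu_ge1 rd)).
pose E' := [set xr : X * R | [/\ E xr.1, 0 < xr.2 &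
  ((tau xr.1 * V xr.1 xr.2)%:E <= \int[mu]_(y in B xr.1 xr.2) (g y)%:E)%E]].
have mgB A : measurable_fun A (EFin \o g).
  by apply: measurable_funTS; exact/measurable_EFinP.
have tauM xr : E' xr -> tau xr.1 * V xr.1 xr.2 <= M.
  move=> [_ _ h]; rewrite -lee_fin; apply: le_trans h (le_trans _ gM).
  apply: ge0_subset_integral => //; first exact: (rd_measurable_ball rd).
  by move=> y _; rewrite lee_fin.
have VM (xr : X * R) : E' xr -> 0 < V xr.1 xr.2 <= M / t0.
  move=> Exr; have [Ex r0 _] := Exr; rewrite (ball_volume_gt0 rd)//=.
  rewrite ler_pdivlMr// mulrC; apply: le_trans (tauM _ Exr).
  by rewrite ler_wpM2r ?(ball_volume_ge0 _ _)// tE.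
have [s [sE sdisj scov]] := greedy_selection (fun xr => B xr.1 xr.2) VM.
pose D n : set X := if s n is Some xr then B xr.1 xr.2 else set0.
pose b n : R := if s n is Some xr then tau xr.1 * V xr.1 xr.2 else 0.
have mD n : measurable (D n).
  by rewrite /D; case: (s n) => [xr|]//; exact: (rd_measurable_ball rd).
have tD : trivIset setT D.
  apply/trivIsetP => i j _ _; rewrite neq_lt /D => /orP[] ij.
    by case si: (s i) => [x|]; case sj: (s j) => [y|]; rewrite ?set0I ?setI0//;
      exact: sdisj ij si sj.
  rewrite setIC; case si: (s i) => [x|]; case sj: (s j) => [y|]; rewrite ?set0I ?setI0//;
    exact: sdisj ij sj si.
have b0 n : 0 <= b n.
  rewrite /b; case sn: (s n) => [xr|]//; have [Ex r0 _] := sE _ _ sn.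
  by rewrite mulr_ge0 ?(ball_volume_ge0 _ _)// (le_trans (ltW t00))// tE.
have sumb N : \sum_(i < N) b i <= M.
  rewrite -lee_fin -sumEFin.
  apply: le_trans (sum_integral_disjoint_le N mD tD mg g0 gM).
  apply: lee_sum => i _; rewrite /b /D; case si: (s i) => [xr|].
    by have [] := sE _ _ si.
  by rewrite integral_set0.
pose h n y : R := if s n is Some xr then
  K * tau xr.1 * \1_(B xr.1 (2 ^+ L * xr.2)) y else 0.
pose a n := K * (Cmu ^+ L * b n).
apply: (upper_integral_le_sup (h := h) (a := a)).
- move=> n; rewrite /h; case: (s n) => [xr|]; last exact: measurable_cst.
  apply: measurable_funM; first exact: measurable_cst.
  by apply: measurable_indic; exact: (rd_measurable_ball rd).
- move=> n y; rewrite /h; case sn: (s n) => [xr|]//; have [Ex r0 _] := sE _ _ sn.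
  by rewrite !mulr_ge0 ?(ltW K0)// (le_trans (ltW t00))// tE.
- move=> n; rewrite /h /a /b; case sn: (s n) => [xr|]; last by rewrite integral0 !mulr0.
  have [Ex r0 _] := sE _ _ sn; have tx := tE _ Ex.
  have tx0 : 0 < tau xr.1 by exact: lt_le_trans tx.
  under eq_integral do rewrite EFinM.
  rewrite ge0_integralZl_EFin//; last 2 first.
  + by apply/measurable_EFinP; apply: measurable_indic; exact: (rd_measurable_ball rd).
  + exact: mulr_ge0 (ltW K0) (ltW tx0).
  rewrite integral_indic ?setIT//; last exact: (rd_measurable_ball rd).
  rewrite (ball_volumeE rd) -EFinM lee_fin -mulrA ler_pM2l// mulrCA ler_pM2l//.
  exact: (ball_volume_doubling rd).
- move=> N; rewrite -mulr_sumr -mulr_sumr ler_pM2l// ler_pM2l//.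
- move=> y; have [Ey|Ey] := pselect (E y); last first.
    by left; rewrite indicE memNset// mul0r.
  right; rewrite indicE mem_set// mul1r; have [r r0 yr] := cE _ Ey.
  have Eyr : E' (y, r) by split.
  have [[n [xr [sn Bxy Vle]]]|hall] := scov _ Eyr; last first.
    (* If [(y, r)] were never blocked, all selected volumes would be at least V(y, r) / 2, and the
       sum of the [b n] would exceed M. *)
    exfalso; have e0 : 0 < t0 * (V y r / 2).
      by rewrite mulr_gt0// divr_gt0// (ball_volume_gt0 rd).
    have eb n : t0 * (V y r / 2) <= b n.
      rewrite /b; have [xr sn Vle] := hall n; rewrite sn.
      have [Ex r0' _] := sE _ _ sn; apply: ler_pM.
      + exact: ltW.
      + by rewrite ltW// divr_gt0// (ball_volume_gt0 rd).
      + exact: tE.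
      + by rewrite ler_pdivrMr// mulrC.
    set e := t0 * _ in e0 eb.
    have := sumb (Num.truncn (M / e)).+1; apply/negP; rewrite -ltNge.
    apply: (@lt_le_trans _ _ (e *+ (Num.truncn (M / e)).+1)).
      by rewrite -mulr_natr mulrC -ltr_pdivrMr// truncnS_gt.
    rewrite -[X in _ *+ X](card_ord) -sumr_const.
    by apply: ler_sum => i _; exact: eb.
  have [Ex r0' _] := sE _ _ sn.
  have sub := eng _ _ _ _ r0' r0 Bxy Vle.
  have By : B xr.1 (2 ^+ L * xr.2) y.
    by apply: sub; rewrite /B/qball/= (rd_dist_eq0 rd _ _).2.
  exists n; rewrite /h sn indicE mem_set// mulr1.
  apply: (slow _ _ _ Ex Ey _ By); first by rewrite mulr_gt0// exprn_gt0.
  apply: (@le_trans _ _ (Cmu ^+ L * (tau xr.1 * V xr.1 xr.2))).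
    rewrite mulrCA ler_wpM2l ?(le_trans (ltW t00) (tE _ Ex))//.
    exact: (ball_volume_doubling rd).
  by rewrite ler_pM2l// tauM//; exact: sE sn.
Qed.

End VitaliWeakType.

(** * Powers, dyadic scales and geometric sums *)

Lemma powR_exprn (R : realType) (x e : R) n : 0 <= x ->
  (x ^+ n) `^ e = (x `^ e) ^+ n.
Proof. by move=> x0; rewrite -powR_mulrn// powRAC powR_mulrn// powR_ge0. Qed.

Lemma dyadic_floor (R : realType) (z : R) : 1 <= z ->
  exists n, 2 ^+ n <= z < 2 ^+ n.+1.
Proof.
move=> z1; have h : exists n, z < 2 ^+ n.
  have [n hn] := exp2_ge z; exists n.+1; apply: le_lt_trans hn _.
  by rewrite ltr_eXn2l ?ltr1n.
case: (ex_minnP h) => -[|n] zn nmin; first by move: zn; rewrite expr0 ltNge z1.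
exists n; rewrite zn andbT leNgt; apply/negP => /nmin; by rewrite ltnn.
Qed.

Lemma dyadic_ceil (R : realType) (z : R) : 1 < z ->
  exists n, 2 ^+ n < z <= 2 ^+ n.+1.
Proof.
move=> z1; case: (ex_minnP (exp2_ge z)) => -[|n] zn nmin.
  by move: zn; rewrite expr0 leNgt z1.
exists n; rewrite zn andbT ltNge; apply/negP => /nmin; by rewrite ltnn.
Qed.

Lemma geometric_sum_le (R : realType) (A q : R) N : 0 <= A -> 0 <= q < 1 ->
  \sum_(i < N) A * q ^+ i <= A / (1 - q).
Proof.
move=> A0 /andP[q0 q1]; rewrite -mulr_sumr ler_wpM2l//.
have q10 : 0 < 1 - q by rewrite subr_gt0.
rewrite -[_^-1]mul1r ler_pdivlMr//.
have := subrX1 q N; have := exprn_ge0 N q0.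
set S := \sum_(i < N) _; set Q := q ^+ N => Q0 QE.
have -> : S * (1 - q) = - ((q - 1) * S) by ring.
by rewrite -QE; lra.
Qed.

(** * Hedberg-type splitting of the potential *)

Section Potential.
Context (R : realType) (d : measure_display) (X : measurableType d).
Variables (dist : X -> X -> R) (mu : {measure set X -> \bar R}).

(** Each point needs only one piece that dominates [h] there, and the masses of the pieces form a
    geometric series. The alternative [h y <= 0] covers the points where a truncated kernel
    vanishes. *)
Lemma upper_integral_le_geometric (D : nat -> set X) (c : nat -> R)
    (f h : X -> R) (A q : R) :
  (forall n, measurable (D n)) -> (forall n, 0 <= c n) ->
  measurable_fun setT f -> (forall y, 0 <= f y) -> 0 <= A -> 0 <= q < 1 ->
  (forall n, ((c n)%:E * \int[mu]_(y in D n) (f y)%:E <= (A * q ^+ n)%:E)%E) ->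
  (forall y, h y <= 0 \/ exists2 n, D n y & h y <= c n * f y) ->
  upper_integral_le mu h (A / (1 - q)).
Proof.
move=> mD c0 mf f0 A0 q01 hA hh.
apply: (upper_integral_le_sup (h := fun n y => c n * (f y * \1_(D n) y))
  (a := fun n => A * q ^+ n)).
- move=> n; apply: measurable_funM => //; apply: measurable_funM => //.
- by move=> n y; rewrite !mulr_ge0.
- move=> n; apply: le_trans (hA n).
  under eq_integral do rewrite EFinM.
  rewrite ge0_integralZl_EFin//; last 2 first.
  + by move=> y _; rewrite lee_fin mulr_ge0.
  + by apply/measurable_EFinP; apply: measurable_funM.
  apply: lee_wpmul2l; rewrite ?lee_fin// [leRHS]integral_mkcond.
  rewrite le_eqVlt; apply/orP; left; apply/eqP; apply: eq_integral => y _.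
  by rewrite patchE indicE; case: ifPn => _; rewrite ?mulr1 ?mulr0.
- by move=> N; exact: geometric_sum_le.
- move=> y; have [hy|[n Dy hy]] := hh y; first by left.
  by right; exists n; rewrite indicE mem_set// mulr1.
Qed.

Variables (A0 Cmu gamma : R).
Hypothesis rd : reverse_doubling_with dist mu A0 Cmu gamma.

Let B := qball dist.
Let V := ball_volume dist mu.


(** Here [v] stands for u(x), so 1/(v - eta) is q(x) and v/(v - eta) is q(x)/p(x). The growth
    condition makes the far part of the potential sum to t / 2; if the near part is not below t / 2,
    one of its dyadic balls carries a large average. The constant depends on [v] only through its
    lower bound [a]. *)
Lemma potential_or_ball (a eta K : R) : 0 < eta < 1 -> eta < a -> 1 <= K ->
  exists2 c, 0 < c & forall x v (f : X -> R) t, a <= v <= 1 -> 0 < t ->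
    measurable_fun setT f -> (forall y, 0 <= f y) ->
    (forall r, 0 < r ->
      (\int[mu]_(y in B x r) (f y)%:E <= (K * V x r `^ (1 - v))%:E)%E) ->
    upper_integral_le mu (fun y => f y / V x (dist x y) `^ (1 - eta)) t \/
    exists2 r, 0 < r & ((c * t `^ (v / (v - eta)) * V x r)%:E <=
      \int[mu]_(y in B x r) (f y)%:E)%E.
Proof.
move=> /andP[eta0 eta1] etaa K1.
have C1 := rd_Cmu_ge1 rd; have C0 : 0 < Cmu := lt_le_trans ltr01 C1.
have K0 : 0 < K := lt_le_trans ltr01 K1.
have pow2_gt1 e : 0 < e -> 1 < (2 : R) `^ e.
  move=> e0; have := gt0_ltr_powR e0 (_ : (1 : R) \in Num.nneg) (_ : (2 : R) \in Num.nneg).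
  by rewrite powR1; apply; rewrite ?nnegrE// ltr1n.
pose th : R := 2 `^ (- (a - eta)).
have th0 : 0 < th by rewrite powR_gt0.
have th1 : th < 1.
  by rewrite /th powRN invf_lt1 ?powR_gt0// pow2_gt1// subr_gt0.
pose th' : R := 2 `^ (- eta).
have th'0 : 0 < th' by rewrite powR_gt0.
have th'1 : th' < 1.
  by rewrite /th' powRN invf_lt1 ?powR_gt0// pow2_gt1.
(* With this constant the geometric sum of the far part is t / 2; its ratio is at most [th], the
   value at v = a. That [D1 >= 1] makes negative powers of [D1] smallest at v = a. *)
pose D1 := 2 * (2 * K * Cmu / (1 - th)).
have D11 : 1 <= D1.
  rewrite /D1 mulrA ler_pdivlMr ?subr_gt0// mul1r.
  have : 1 <= K * Cmu by rewrite mulr_ege1.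
  by move: th0; nra.
have D10 : 0 < D1 := lt_le_trans ltr01 D11.
(* Makes the geometric sum of the near part, of ratio [th'], equal to t / 2. *)
pose c1 := (1 - th') / 4.
have c10 : 0 < c1 by rewrite divr_gt0// subr_gt0.
exists (c1 / Cmu * D1 `^ (- (eta / (a - eta)))).
  by apply: mulr_gt0; [exact: divr_gt0|exact: powR_gt0].
move=> x v f t /andP[av v1] t0 mf f0 hf.
have w0 : 0 < v - eta by rewrite subr_gt0 (lt_le_trans etaa).
(* At this level the part of the potential where [V >= s] is at most [t / 2]. *)
pose s := (t / D1) `^ (- (v - eta)^-1).
have tD0 : 0 < t / D1 by rewrite divr_gt0.
have s0 : 0 < s by rewrite powR_gt0.
have sw : s `^ (- (v - eta)) = t / D1.
  by rewrite /s -powRrM mulrNN mulVf ?gt_eqF// powRr1// ltW.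
have hf' r : (\int[mu]_(y in B x r) (f y)%:E <= (K * V x r `^ (1 - v))%:E)%E.
  have [r0|r0] := ltP 0 r; first exact: hf.
  rewrite /B (qball_le0 _ (rd_dist_ge0 rd))// integral_set0 lee_fin.
  by rewrite mulr_ge0 ?powR_ge0// ltW.
have Vpos y : y <> x -> 0 < V x (dist x y).
  move=> yx; apply: (ball_volume_gt0 rd).
  rewrite lt_neqAle (rd_dist_ge0 rd) andbT eq_sym; apply/eqP => /(rd_dist_eq0 rd).
  by move=> xy; apply: yx.
have V00 : V x (dist x x) = 0.
  by rewrite (rd_dist_eq0 rd _ _).2// /V/ball_volume (qball_le0 _ (rd_dist_ge0 rd))// measure0.
have decr b c : 0 < b -> b <= c -> c `^ (eta - 1) <= b `^ (eta - 1).
  move=> b0 bc; have c0 : 0 < c := lt_le_trans b0 bc.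
  rewrite -opprB !powRN lef_pV2 ?posrE ?powR_gt0//.
  by apply: ge0_ler_powR; rewrite ?nnegrE ?subr_ge0 ?(ltW eta1) ?(ltW b0) ?(ltW c0).
have kerE b : (b `^ (1 - eta))^-1 = b `^ (eta - 1) by rewrite -powRN opprB.
have e2 n : 0 < (2 : R) ^+ n by rewrite exprn_gt0.
have [rf hrf hVf] : exists2 rf : nat -> R, forall n, V x (rf n) <= Cmu * (2 ^+ n.+1 * s) &
    forall n y, y <> x -> V x (dist x y) < 2 ^+ n.+1 * s -> dist x y < rf n.
  have ex n := small_volume_ball rd x (mulr_gt0 (e2 n.+1) s0).
  have [g hg] := choice (fun n => let: ex_intro2 r h1 h2 := ex n in
    ex_intro (fun r => V x r <= Cmu * (2 ^+ n.+1 * s) /\ forall y, y <> x ->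
     V x (dist x y) < 2 ^+ n.+1 * s -> dist x y < r) r (conj h1 h2)).
  by exists g => n; have [] := hg n.
have s2n n : 0 < s / 2 ^+ n by rewrite divr_gt0.
have [rn hrn hVn] : exists2 rn : nat -> R, forall n, V x (rn n) <= Cmu * (s / 2 ^+ n) &
    forall n y, y <> x -> V x (dist x y) < s / 2 ^+ n -> dist x y < rn n.
  have ex n := small_volume_ball rd x (s2n n).
  have [g hg] := choice (fun n => let: ex_intro2 r h1 h2 := ex n in
    ex_intro (fun r => V x r <= Cmu * (s / 2 ^+ n) /\ forall y, y <> x ->
     V x (dist x y) < s / 2 ^+ n -> dist x y < r) r (conj h1 h2)).
  by exists g => n; have [] := hg n.
have pos1 : 0 < c1 * t * s `^ (- eta) by rewrite mulr_gt0 ?powR_gt0// mulr_gt0.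
pose far y : R := if s <= V x (dist x y)
  then f y / V x (dist x y) `^ (1 - eta) else 0.
pose near y : R := if s <= V x (dist x y) then 0
  else f y / V x (dist x y) `^ (1 - eta).
have hfar : upper_integral_le mu far (t / 2).
  have -> : t / 2 = 2 * K * Cmu * (t / D1) / (1 - th).
    by rewrite /D1; field; rewrite ?gt_eqF// subr_gt0.
  apply: (upper_integral_le_geometric (D := fun n => B x (rf n))
    (c := fun n => (2 ^+ n * s) `^ (eta - 1)) (f := f)) => //.
  - by move=> n; exact: (rd_measurable_ball rd).
  - by move=> n; exact: powR_ge0.
  - by apply/ltW; rewrite mulr_gt0// !mulr_gt0.
  - by rewrite ltW.
  - move=> n; have ns0 : 0 < 2 ^+ n * s by rewrite mulr_gt0.
    have Cn0 : 0 < 2 * Cmu * (2 ^+ n * s) by rewrite mulr_gt0// mulr_gt0.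
    apply: (@le_trans _ _ (((2 ^+ n * s) `^ (eta - 1))%:E *
      (K * (2 * Cmu * (2 ^+ n * s) `^ (1 - v)))%:E)%E).
      apply: lee_wpmul2l; first by rewrite lee_fin powR_ge0.
      apply: le_trans (hf' _) _; rewrite lee_fin ler_pM2l//.
      apply: (@le_trans _ _ ((2 * Cmu * (2 ^+ n * s)) `^ (1 - v))).
        apply: ge0_ler_powR; rewrite ?nnegrE ?subr_ge0 ?(ball_volume_ge0 _ _) ?(ltW Cn0)//.
        by apply: le_trans (hrf n) _; rewrite exprS le_eqVlt; apply/orP; left; apply/eqP; ring.
      rewrite powRM ?(ltW ns0) ?mulr_ge0 ?(ltW C0)// ler_wpM2r ?powR_ge0//.
      rewrite -[leRHS]powRr1 ?mulr_ge0 ?(ltW C0)// ler_powR// ?mulr_ege1 ?ler1n//.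
      by rewrite lerBlDr lerDl; move: av eta0 etaa; lra.
    rewrite -EFinM lee_fin.
    have E1 : (2 ^+ n * s) `^ (eta - 1) * (2 ^+ n * s) `^ (1 - v) =
        (2 `^ (- (v - eta))) ^+ n * (t / D1).
      rewrite -powRD; last by rewrite (gt_eqF ns0) implybT.
      by rewrite (_ : _ + _ = - (v - eta)) ?powRM ?ltW// ?sw ?powR_exprn//; ring.
    have -> : (2 ^+ n * s) `^ (eta - 1) * (K * (2 * Cmu * (2 ^+ n * s) `^ (1 - v))) =
        2 * K * Cmu * (t / D1) * (2 `^ (- (v - eta))) ^+ n.
      rewrite -[RHS]mulrA [t / D1 * _]mulrC -E1; ring.
    rewrite ler_pM2l; last by rewrite mulr_gt0// !mulr_gt0.
    rewrite lerXn2r ?nnegrE ?powR_ge0//.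
    by rewrite ler_powR ?ler1n// lerN2 lerB.
  - move=> y; rewrite /far; case: ifPn => sV; last by left.
    have yx : y <> x by move=> yx; move: sV; rewrite yx V00 leNgt s0.
    right; have [n /andP[h1 h2]] : exists n, 2 ^+ n <= V x (dist x y) / s < 2 ^+ n.+1.
      by apply: dyadic_floor; rewrite ler_pdivlMr// mul1r.
    exists n; first by apply: hVf => //; rewrite -ltr_pdivrMr.
    rewrite mulrC ler_wpM2r// kerE; apply: decr; first by rewrite mulr_gt0.
    by rewrite -ler_pdivlMr.
(* Small mass in every ball [rn n] lets the near part be summed; otherwise one such ball has average
   at least c1 t s^(-eta) / Cmu. *)
have [hsmall|hbig] := pselect (forall n,
    (\int[mu]_(y in B x (rn n)) (f y)%:E <= (c1 * t * s `^ (- eta) * (s / 2 ^+ n))%:E)%E).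
- left; have hnear : upper_integral_le mu near (t / 2).
    have -> : t / 2 = 2 * c1 * t / (1 - th').
      by rewrite /c1; field; rewrite ?gt_eqF// subr_gt0.
    apply: (upper_integral_le_geometric (D := fun n => B x (rn n))
      (c := fun n => (s / 2 ^+ n.+1) `^ (eta - 1)) (f := f)) => //.
    + by move=> n; exact: (rd_measurable_ball rd).
    + by move=> n; exact: powR_ge0.
    + by apply/ltW; rewrite mulr_gt0// mulr_gt0.
    + by rewrite ltW.
    + move=> n; apply: (@le_trans _ _ (((s / 2 ^+ n.+1) `^ (eta - 1))%:E *
        (c1 * t * s `^ (- eta) * (s / 2 ^+ n))%:E)%E).
        by apply: lee_wpmul2l; first by rewrite lee_fin powR_ge0.
      rewrite -EFinM lee_fin.
      have E1 : (s / 2 ^+ n.+1) `^ (eta - 1) = 2 `^ (1 - eta) * (s / 2 ^+ n) `^ (eta - 1).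
        rewrite (_ : s / 2 ^+ n.+1 = 2^-1 * (s / 2 ^+ n)); last first.
          by rewrite exprS; field; rewrite gt_eqF.
        by rewrite [LHS]powRM ?invr_ge0 ?(ltW (s2n n))// -[2^-1]powR_inv1// -powRrM mulN1r opprB.
      have E2 : (s / 2 ^+ n) `^ (eta - 1) * (s / 2 ^+ n) = s `^ eta * th' ^+ n.
        rewrite -[X in _ * X]powRr1 ?(ltW (s2n n))// -powRD ?(gt_eqF (s2n n)) ?implybT//.
        rewrite subrK powRM ?(ltW s0) ?invr_ge0 ?(ltW (e2 n))//; congr (_ * _).
        by rewrite -powR_inv1 ?(ltW (e2 n))// -powRrM mulN1r /th' powR_exprn.
      have E3 : s `^ (- eta) * s `^ eta = 1.
        by rewrite powRN mulVf// gt_eqF// powR_gt0.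
      have -> : (s / 2 ^+ n.+1) `^ (eta - 1) * (c1 * t * s `^ (- eta) * (s / 2 ^+ n)) =
         2 `^ (1 - eta) * c1 * t * th' ^+ n.
        rewrite E1.
        transitivity (2 `^ (1 - eta) * c1 * t * s `^ (- eta) *
          ((s / 2 ^+ n) `^ (eta - 1) * (s / 2 ^+ n))); first ring.
        rewrite E2 -[RHS]mulr1 -E3; ring.
      rewrite ler_pM2r ?exprn_gt0// ler_pM2r// ler_pM2r//.
      by rewrite -[leRHS]powRr1// ler_powR ?ler1n// lerBlDr lerDl ltW.
    + move=> y; rewrite /near; case: ifPn => [|/negbTE sV]; first by left.
      have [->|/eqP yx] := eqVneq y x.
        (* On the diagonal the ball is empty and the kernel is 0, since 0^-1 = 0. *)
        by left; rewrite V00 powR0 ?invr0 ?mulr0// gt_eqF// subr_gt0.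
      right; have Vs : V x (dist x y) < s by rewrite ltNge sV.
      have [n /andP[h1 h2]] : exists n, 2 ^+ n < s / V x (dist x y) <= 2 ^+ n.+1.
        by apply: dyadic_ceil; rewrite ltr_pdivlMr ?Vpos// mul1r.
      exists n.
        by apply: hVn => //; rewrite ltr_pdivlMr// mulrC -ltr_pdivlMr// Vpos.
      rewrite mulrC ler_wpM2r// kerE; apply: decr => //.
      by rewrite ler_pdivrMr// mulrC -ler_pdivrMr// Vpos.
  apply: (upper_integral_leS _ _ (upper_integral_leD hfar hnear)).
    by move=> y; rewrite /far /near; case: ifPn => _; rewrite ?addr0 ?add0r.
  by rewrite -splitr.
- right; have {hbig}[n /negP] : exists n,
      ~ (\int[mu]_(y in B x (rn n)) (f y)%:E <=
        (c1 * t * s `^ (- eta) * (s / 2 ^+ n))%:E)%E.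
    exact/existsNP.
  rewrite -ltNge => hn.
  have r0 : 0 < rn n.
    rewrite ltNge; apply/negP => r0; move: hn.
    rewrite /B (qball_le0 _ (rd_dist_ge0 rd))// integral_set0 lte_fin ltNge.
    by rewrite ltW// mulr_gt0.
  exists (rn n) => //; apply: le_trans (ltW hn); rewrite lee_fin.
  apply: (@le_trans _ _ (c1 * t * s `^ (- eta) * (V x (rn n) / Cmu))); last first.
    rewrite ler_wpM2l//; first exact: ltW.
    by rewrite ler_pdivrMr// mulrC.
  (* By the choice of [s], the quantity t s^(-eta) is t^(v/(v - eta)) times a power of [D1] that is
     bounded below uniformly in [v >= a]. *)
  have key : D1 `^ (- (eta / (a - eta))) * t `^ (v / (v - eta)) <= t * s `^ (- eta).
    have -> : s `^ (- eta) = D1 `^ (- (eta / (v - eta))) * t `^ (eta / (v - eta)).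
      rewrite /s -powRrM mulrNN [_ * eta]mulrC powRM ?invr_ge0 ?(ltW D10) ?(ltW t0)//.
      by rewrite [LHS]mulrC -[D1^-1]powR_inv1 ?(ltW D10)// -powRrM mulN1r.
    have -> : t `^ (v / (v - eta)) = t * t `^ (eta / (v - eta)).
      have -> : v / (v - eta) = 1 + eta / (v - eta) by field; rewrite gt_eqF.
      by rewrite powRD ?powRr1 ?(ltW t0)// (gt_eqF t0) implybT.
    rewrite mulrCA ler_pM2l// ler_wpM2r ?powR_ge0// ler_powR// lerN2.
    by rewrite ler_pM2l// lef_pV2 ?posrE ?subr_gt0 ?lerD2r// (lt_le_trans etaa).
  have VC0 : 0 <= c1 * (V x (rn n) / Cmu).
    by apply: mulr_ge0; [exact: ltW|apply: divr_ge0; [exact: ball_volume_ge0|exact: ltW]].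
  have := ler_wpM2l VC0 key; set z1 := D1 `^ _; set z2 := t `^ _; set z3 := s `^ _.
  by move=> h; apply: le_trans (le_trans h _); rewrite le_eqVlt; apply/orP; left; apply/eqP; ring.
Qed.

End Potential.

(** * Log-Hoelder continuity and volumes of balls *)

Section Oscillation.
Context (R : realType) (d : measure_display) (X : measurableType d).
Variables (dist : X -> X -> R) (mu : {measure set X -> \bar R}).
Variables (A0 Cmu gamma : R).
Hypothesis rd : reverse_doubling_with dist mu A0 Cmu gamma.

Let B := qball dist.
Let V := ball_volume dist mu.
Let A00 : 0 < A0 := lt_le_trans ltr01 (rd_A0_ge1 rd).

(** B(x, A0 (1 + d(x, x0))) contains B(x0, 1), and about log_2 of the ratio of the radii is the
    number of doublings that lead there from B(x, r). *)
Lemma ball_volume_lower (x0 : X) : exists K N, [/\ 0 <= K, 0 <= N &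
  forall x r, 0 < r ->
    - ln (V x r) <= K + N * Num.max 0 (ln (A0 * (1 + dist x x0) / r))].
Proof.
have C1 := rd_Cmu_ge1 rd; have C0 : 0 < Cmu := lt_le_trans ltr01 C1.
have ln20 : 0 < ln (2 : R) by rewrite ln_gt0// ltr1n.
have lnC : 0 <= ln Cmu by exact: ln_ge0.
exists (`|ln (V x0 1)| + ln Cmu), (ln Cmu / ln 2); split.
- by rewrite addr_ge0.
- by rewrite divr_ge0// ltW.
move=> x r r0; set R0 := A0 * _.
have R00 : 0 < R0 by rewrite mulr_gt0// ltr_pwDl// (rd_dist_ge0 rd).
have sub : B x0 1 `<=` B x R0.
  move=> y; rewrite /B/qball/= => hy.
  apply: le_lt_trans (rd_dist_triangle rd x y x0) _.
  by rewrite ltr_pM2l// (rd_distC rd y) addrC ltrD2r.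
have [n hn nle] : exists2 n, R0 <= 2 ^+ n * r &
    n%:R * ln 2 <= Num.max 0 (ln (R0 / r)) + ln 2.
  have [Rr|rR] := leP (R0 / r) 1.
    exists 0%N; first by rewrite expr0 -ler_pdivrMr.
    by rewrite mul0r addr_ge0 ?(ltW ln20)// le_max lexx.
  have [n /andP[h1 h2]] := dyadic_ceil rR.
  exists n.+1; first by rewrite -ler_pdivrMr.
  rewrite -natr1 mulrDl mul1r lerD2r le_max; apply/orP; right.
  by rewrite mulr_natl -lnXn// ler_ln ?posrE ?exprn_gt0 ?divr_gt0// ltW.
have Vx : V x0 1 <= Cmu ^+ n * V x r.
  apply: le_trans (subset_ball_volume rd sub) _.
  exact: (ball_volume_doubling rd).
have V0 y s : 0 < s -> 0 < V y s by exact: (ball_volume_gt0 rd).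
have : ln (V x0 1) <= n%:R * ln Cmu + ln (V x r).
  rewrite mulr_natl -lnXn// -lnM ?posrE ?exprn_gt0 ?V0//.
  by rewrite ler_ln ?posrE ?mulr_gt0 ?exprn_gt0 ?V0.
have : n%:R * ln Cmu <= ln Cmu / ln 2 * Num.max 0 (ln (R0 / r)) + ln Cmu.
  have := ler_wpM2l (divr_ge0 lnC (ltW ln20)) nle.
  rewrite mulrDr mulfVK ?gt_eqF//; apply: le_trans.
  by rewrite mulrCA mulfVK ?gt_eqF.
have := ler_norm (- ln (V x0 1)); rewrite normrN; lra.
Qed.

(* A ball of small radius relative to the distance to [x0] sits in a region
   where the decay condition controls the oscillation; a ball of large radius
   has measure bounded below. *)
Lemma log_holder_oscillation (x0 : X) (u : X -> R) :
  (forall x, 0 <= u x <= 1) -> LH dist x0 u ->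
  exists2 K, 0 <= K & forall x y r, dist x y < r ->
    `|u x - u y| * - ln (V x r) <= K.
Proof.
move=> u01 [[c0 hc0] [ci [ui hui]]].
have [K [N [K0 N0 hV]]] := ball_volume_lower x0.
have lnA : 0 <= ln A0 by rewrite ln_ge0// (rd_A0_ge1 rd).
have e1 : 1 <= expR 1 :> R by rewrite -expR0 ler_expR.
have dx x : 0 <= dist x x0 by exact: (rd_dist_ge0 rd).
have le1 x : 1 <= ln (expR 1 + dist x x0).
  by rewrite -{1}(expRK 1) ler_ln ?posrE ?expR_gt0 ?lerDl// ltr_pwDl ?expR_gt0.
have {}hui x : `|u x - ui| * ln (expR 1 + dist x x0) <= ci.
  by rewrite -ler_pdivlMr// (lt_le_trans ltr01).
have ci0 : 0 <= ci.
  by apply: le_trans (hui x0); rewrite mulr_ge0// (le_trans ler01).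
have ln2 : 0 <= ln (2 : R) by rewrite ln_ge0// ler1n.
have ln2A : 0 <= ln (2 * A0).
  by rewrite ln_ge0// mulr_ege1 ?ler1n// (rd_A0_ge1 rd).
(* Chosen so that r < R0 / kap gives A0 r < (1 + d(x, x0)) / 2: then d(x, x0) is bounded by 1 plus a
   multiple of d(y, x0). *)
pose kap := 2 * A0 ^+ 2.
have kap0 : 0 < kap by rewrite mulr_gt0// exprn_gt0.
have lnk : 0 <= ln kap.
  by rewrite ln_ge0// mulr_ege1 ?ler1n// exprn_ege1// (rd_A0_ge1 rd).
have c00 : 0 <= Num.max 0 c0 by rewrite le_max lexx.
pose M := ln kap + ln A0 + (2 * ci + ln (2 * A0)) + ln 2 + Num.max 0 c0.
have M0 : 0 <= M by rewrite !addr_ge0// mulr_ge0.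
exists (K + N * M); first by rewrite addr_ge0// mulr_ge0.
move=> x y r xyr.
have r0 : 0 < r by apply: le_lt_trans xyr; exact: (rd_dist_ge0 rd).
have du1 : `|u x - u y| <= 1.
  by have := u01 x; have := u01 y; rewrite ler_norml => /andP[? ?] /andP[? ?]; lra.
have du0 := normr_ge0 (u x - u y).
apply: le_trans (ler_wpM2l du0 (hV x r r0)) _.
rewrite mulrDr lerD//.
  by apply: le_trans (ler_wpM2r K0 du1) _; rewrite mul1r.
rewrite mulrCA ler_wpM2l//.
set R0 := A0 * _.
have R00 : 0 < R0 by rewrite mulr_gt0// ltr_pwDl// (rd_dist_ge0 rd).
have [hR|hR] := leP (R0 / r) kap.
  apply: (@le_trans _ _ (ln kap)); last by rewrite /M; lra.
  apply: (@le_trans _ _ (1 * ln kap)); last by rewrite mul1r.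
  apply: ler_pM => //; first by rewrite le_max lexx.
  by rewrite ge_max lnk/= ler_ln ?posrE ?divr_gt0.
have rsmall : kap * r < R0 by rewrite -ltr_pdivlMr.
have key : dist x x0 <= 1 + 2 * A0 * dist y x0.
  have := rd_dist_triangle rd x x0 y; rewrite (rd_distC rd x0 y).
  have A0r : A0 * r < (1 + dist x x0) / 2.
    move: rsmall; rewrite /kap /R0 expr2 => h.
    rewrite ltr_pdivlMr// -(ltr_pM2l A00); apply: le_lt_trans h.
    by rewrite le_eqVlt; apply/orP; left; apply/eqP; ring.
  rewrite mulrDr; have := ltr_pM2l A00 (dist x y) r; rewrite xyr => h1.
  by move: A0r h1 => ? ? ?; lra.
have lnle : ln (expR 1 + dist x x0) <= ln (2 * A0) + ln (expR 1 + dist y x0).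
  rewrite -lnM ?posrE ?mulr_gt0 ?ltr_pwDl ?expR_gt0//.
  rewrite ler_ln ?posrE ?mulr_gt0 ?ltr_pwDl ?expR_gt0//.
  rewrite mulrDr; have A1 := rd_A0_ge1 rd; have := expR_gt0 (1 : R).
  by move: e1 key => ? ? ?; nra.
have hinf : `|u x - u y| * ln (expR 1 + dist x x0) <= 2 * ci + ln (2 * A0).
  have tri : `|u x - u y| <= `|u x - ui| + `|u y - ui|.
    by rewrite (distrC (u y)); apply: ler_distD.
  have uy1 : `|u x - u y| * ln (2 * A0) <= ln (2 * A0).
    by rewrite -[leRHS]mul1r ler_wpM2r.
  have := hui x; have := hui y; have a0 := normr_ge0 (u x - ui).
  have b0 := normr_ge0 (u y - ui).
  have := le1 x; have := le1 y; move: tri uy1 lnle.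
  set D := `|u x - u y|; set a := `|u x - ui| in a0 *; set b := `|u y - ui| in b0 *.
  set Lx := ln (expR 1 + dist x x0); set Ly := ln (expR 1 + dist y x0).
  move=> tri uy1 lnle Ly1 Lx1 hb ha.
  have [LL|LL] := leP Lx Ly.
    have : D * Lx <= (a + b) * Lx by rewrite ler_wpM2r// (le_trans ler01).
    have : b * Lx <= b * Ly by rewrite ler_wpM2l.
    lra.
  have : D * Lx <= D * (ln (2 * A0) + Ly) by rewrite ler_wpM2l.
  have : D * Ly <= (a + b) * Ly by rewrite ler_wpM2r// (le_trans ler01).
  have : a * Ly <= a * Lx by rewrite ler_wpM2l// ltW.
  lra.
have h0 : `|u x - u y| * - ln r <= Num.max 0 c0 + ln 2.
  have [r2|r2] := leP (1 / 2) r.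
    have lnr : - ln r <= ln 2.
      rewrite lerNl -lnV ?posrE// ler_ln ?posrE ?invr_gt0//; lra.
    apply: le_trans (ler_wpM2l du0 lnr) _.
    by apply: le_trans (ler_wpM2r ln2 du1) _; rewrite mul1r lerDr.
  have [->|/eqP xy] := eqVneq x y; first by rewrite subrr normr0 mul0r addr_ge0.
  have dxy0 : 0 < dist x y.
    rewrite lt_neqAle (rd_dist_ge0 rd) andbT eq_sym; apply/eqP.
    by move=> /(rd_dist_eq0 rd).
  have dxy : dist x y < 1 / 2 by exact: lt_trans r2.
  have lnd : 0 < - ln (dist x y).
    by rewrite oppr_gt0 ln_lt0// dxy0; lra.
  have := hc0 _ _ xy dxy.
  have -> : - c0 / ln (dist x y) = c0 / (- ln (dist x y)).
    by rewrite invrN mulrN mulNr.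
  rewrite ler_pdivlMr// => hd.
  have lndr : - ln r <= - ln (dist x y).
    by rewrite lerN2 ler_ln ?posrE// ltW.
  apply: le_trans (ler_wpM2l du0 lndr) _; apply: (le_trans hd).
  by rewrite ler_wpDr// le_max lexx orbT.
(* The logarithm of R0 / r splits into a constant, a term for the decay condition at infinity
   ([hinf]) and -ln r for the local condition ([h0]). *)
have lnR : ln (R0 / r) <= ln A0 + ln (expR 1 + dist x x0) - ln r.
  rewrite ln_div ?posrE// /R0 lnM ?posrE// ?lerD2r ?lerD2l; last first.
    by rewrite ltr_pwDl.
  by rewrite ler_ln ?posrE ?lerD2r// ltr_pwDl// expR_gt0.
have [z0|z0] := leP (ln (R0 / r)) 0; first by rewrite mulr0.
apply: le_trans (ler_wpM2l du0 lnR) _.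
rewrite mulrDr mulrDr.
have : `|u x - u y| * ln A0 <= ln A0 by rewrite -[leRHS]mul1r ler_wpM2r.
by rewrite /M; lra.
Qed.

End Oscillation.

(** * Weak-type estimate from a growth condition *)

Section WeakType.
Context (R : realType) (d : measure_display) (X : measurableType d).
Variables (dist : X -> X -> R) (mu : {measure set X -> \bar R}).

Lemma powR_le_expR (x e Q : R) : 0 < x -> e * ln x <= Q -> x `^ e <= expR Q.
Proof. by move=> x0; rewrite /powR gt_eqF// ler_expR. Qed.

Lemma dist_inv_le (a b c : R) : 0 < a -> a <= b -> a <= c ->
  `|b^-1 - c^-1| <= a^-1 ^+ 2 * `|b - c|.
Proof.
move=> a0 ab ac; have b0 := lt_le_trans a0 ab; have c0 := lt_le_trans a0 ac.
have -> : b^-1 - c^-1 = (b^-1 * c^-1) * (c - b) by field; rewrite !gt_eqF.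
rewrite normrM distrC ler_wpM2r// ger0_norm ?mulr_ge0 ?invr_ge0 ?(ltW b0) ?(ltW c0)//.
by rewrite expr2 ler_pM ?invr_ge0 ?(ltW b0) ?(ltW c0)// lef_pV2 ?posrE.
Qed.

(** Where x > l the factor (x / l)^(e - 1) is at least 1. *)
Lemma le_add_powR (x l e : R) : 0 <= x -> 0 < l -> 1 <= e ->
  x <= l + x `^ e * l `^ (1 - e).
Proof.
move=> x0 l0 e1; have [xl|lx] := leP x l.
  by rewrite (le_trans xl)// lerDl mulr_ge0 ?powR_ge0.
have {}x0 := lt_trans l0 lx.
apply: (@le_trans _ _ (x `^ e * l `^ (1 - e))); last by rewrite lerDr ltW.
rewrite -{1}[x]powRr1 ?(ltW x0)// -{1}(subrKC e 1) powRD ?(gt_eqF x0) ?implybT//.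
rewrite ler_wpM2l ?powR_ge0// -(opprB e) !powRN lef_pV2 ?posrE ?powR_gt0//.
by apply: ge0_ler_powR; rewrite ?nnegrE ?subr_ge0 ?(ltW x0) ?(ltW l0) ?(ltW lx).
Qed.

Variables (A0 Cmu gamma : R).
Hypothesis rd : reverse_doubling_with dist mu A0 Cmu gamma.

Let B := qball dist.
Let V := ball_volume dist mu.

(* A substitute for Jensen's inequality that tolerates a variable exponent. *)
Lemma ball_integral_le (f e : X -> R) x r l K G :
  measurable_fun setT f -> (forall y, 0 <= f y) ->
  measurable_fun setT (fun y => f y `^ e y) -> (forall y, 1 <= e y) ->
  0 < l -> 0 <= K ->
  (forall y, B x r y -> l `^ (1 - e y) <= K * l `^ (1 - e x)) ->
  (\int[mu]_(y in B x r) (f y `^ e y)%:E <= G%:E)%E ->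
  (\int[mu]_(y in B x r) (f y)%:E <=
    (l * V x r + K * l `^ (1 - e x) * G)%:E)%E.
Proof.
move=> mf f0 mg e1 l0 K0 hK hG.
have mB : measurable (B x r) by exact: (rd_measurable_ball rd).
have k0 : 0 <= K * l `^ (1 - e x) by rewrite mulr_ge0 ?powR_ge0.
apply: (@le_trans _ _ (\int[mu]_(y in B x r)
    (l%:E + (K * l `^ (1 - e x))%:E * (f y `^ e y)%:E))%E).
  apply: ge0_le_integral => //.
  - by move=> y _; rewrite lee_fin.
  - by apply: measurable_funTS; apply/measurable_EFinP.
  - apply: emeasurable_funD => //; apply: measurable_funeM.
    by apply: measurable_funTS; apply/measurable_EFinP.
  - move=> y By; rewrite -EFinM -EFinD lee_fin.
    apply: le_trans (le_add_powR (f0 y) l0 (e1 y)) _.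
    by rewrite lerD2l mulrC ler_wpM2r ?powR_ge0// hK.
rewrite ge0_integralD//; last 3 first.
- by move=> y _; rewrite lee_fin ltW.
- by move=> y _; rewrite -EFinM lee_fin mulr_ge0 ?powR_ge0.
- by apply: measurable_funeM; apply: measurable_funTS; apply/measurable_EFinP.
rewrite integral_cst// ge0_integralZl_EFin//; last 2 first.
- by move=> y _; rewrite lee_fin powR_ge0.
- by apply: measurable_funTS; apply/measurable_EFinP.
rewrite /B (ball_volumeE rd) EFinD -!EFinM leeD//.
by rewrite [leRHS]EFinM lee_wpmul2l.
Qed.

Variables (a eta : R).
Hypotheses (eta01 : 0 < eta < 1) (etaa : eta < a).

(** For [f >= 0] this contains the set where the fractional integral exceeds t; defined by failure
    of an upper bound, it is subadditive in [f]. *)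
Definition potential_exceeds (f : X -> R) (t : R) : set X :=
  [set x | ~ upper_integral_le mu
    (fun y => f y / V x (dist x y) `^ (1 - eta)) t].

Lemma weak_type_of_growth (K0 K M : R) : 0 <= K0 -> 1 <= K -> 1 <= M ->
  exists C, forall (v f : X -> R) t, 0 < t -> (forall x, a <= v x <= 1) ->
    (forall x y r, dist x y < r -> `|v x - v y| * - ln (V x r) <= K0) ->
    1 <= t \/ (forall x y, v x = v y) ->
    measurable_fun setT f -> (forall y, 0 <= f y) ->
    measurable_fun setT (fun y => f y `^ (v y)^-1) ->
    (\int[mu]_y (f y `^ (v y)^-1)%:E <= M%:E)%E ->
    (forall x r, 0 < r ->
      (\int[mu]_(y in B x r) (f y)%:E <= (K * V x r `^ (1 - v x))%:E)%E) ->
    upper_integral_le mu (fun x => \1_(potential_exceeds f t) x *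
      t `^ (v x - eta)^-1) C.
Proof.
move=> K00 K1 M1; have [c' c'0 pot] := potential_or_ball rd eta01 etaa K1.
have /andP[eta0 eta1] := eta01.
have a0 : 0 < a := lt_trans eta0 etaa.
have w0 : 0 < a - eta by rewrite subr_gt0.
have [A A1 vit] := vitali_weak_type rd.
pose c := Num.min c' 1.
have c0 : 0 < c by rewrite lt_min c'0/=.
have c1 : c <= 1 by rewrite ge_min lexx orbT.
have cc' : c <= c' by rewrite ge_min lexx.
have c20 : 0 < c / 2 by rewrite divr_gt0.
have c21 : c / 2 <= 1 by move: c1; lra.
have lnc2 : 0 <= - ln (c / 2) by rewrite oppr_ge0 ln_le0.
have lnK : 0 <= ln K by exact: ln_ge0.
(* Bounds the logarithm of l^(1/v(x) - 1/v(y)): the first summand serves l >= 1, the second c/2 <= l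
   < 1. *)
pose Q' := a^-1 ^+ 2 * (ln K + K0) + a^-1 * - ln (c / 2).
have Q'0 : 0 <= Q'.
  by rewrite addr_ge0// mulr_ge0 ?addr_ge0 ?exprn_ge0 ?invr_ge0 ?(ltW a0).
pose K' := expR Q'.
have K'0 : 0 < K' by exact: expR_gt0.
pose kap := (c / 2) `^ a^-1 / K'.
have kap0 : 0 < kap by rewrite divr_gt0// powR_gt0.
(* Bounds the logarithm of the ratio of the levels t^(1/(v - eta)) at two points of an enlarged
   ball. *)
pose Q'' := (a - eta)^-1 ^+ 2 * (`|ln (A * M / kap)| + K0).
have Q''0 : 0 <= Q''.
  by rewrite mulr_ge0 ?addr_ge0 ?exprn_ge0 ?invr_ge0 ?(ltW w0).
pose K'' := expR Q''.
have K''1 : 1 <= K'' by rewrite /K'' -expR0 ler_expR.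
have AM0 : 0 < A * M by rewrite mulr_gt0// (lt_le_trans ltr01).
exists (kap^-1 * (K'' * (A * M))) => v f t t0 va osc tv mf f0 mg hM grow.
have va1 x : a <= v x by have /andP[] := va x.
have v0 x : 0 < v x := lt_le_trans a0 (va1 x).
have v1 x : v x <= 1 by have /andP[] := va x.
have wx x : a - eta <= v x - eta by rewrite lerD2r.
have wx0 x : 0 < v x - eta := lt_le_trans w0 (wx x).
have dv1 x y : `|v x - v y| <= 1.
  have := v0 x; have := v0 y; have := v1 x; have := v1 y.
  by rewrite ler_norml => *; apply/andP; split; lra.
have t1w x : 1 <= t -> 1 <= t `^ (v x / (v x - eta)).
  by move=> t1; rewrite -(powRr0 t) ler_powR// divr_ge0// ltW.
suff hv : upper_integral_le mu (fun x => \1_(potential_exceeds f t) x *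
    (kap * t `^ (v x - eta)^-1)) (K'' * (A * M)).
  have := upper_integral_leZ (ltW (_ : 0 < kap^-1)) hv.
  rewrite invr_gt0 => /(_ kap0); apply: upper_integral_leS => // x.
  by rewrite mulrCA mulKf// gt_eqF.
apply: (vit M K'' (kap * Num.min 1 (t `^ (a - eta)^-1)) _
  (fun y => f y `^ (v y)^-1)) => //.
- exact: le_trans M1.
- by rewrite mulr_gt0// lt_min ltr01 powR_gt0.
- by move=> y; exact: powR_ge0.
- move=> x _; rewrite ler_pM2l// ge_min; have [t1|t1] := leP 1 t.
    by apply/orP; left; rewrite -(powRr0 t) ler_powR// invr_ge0 ltW.
  apply/orP; right; apply: ger_powR; first by rewrite t0 ltW.
  by rewrite lef_pV2 ?posrE.
- move=> x Ex; case: (pot x (v x) f t (va x) t0 mf f0) => [r r0|//|[r r0 hr]].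
    exact: grow.
  (* Half of the guaranteed average, so that the term l V produced by [ball_integral_le] can be
     absorbed on the left. *)
  exists r => //; set l := c / 2 * t `^ (v x / (v x - eta)).
  have l0 : 0 < l by rewrite mulr_gt0// powR_gt0.
  have V0 : 0 < V x r by exact: (ball_volume_gt0 rd).
  have lV : ((2 * l * V x r)%:E <= \int[mu]_(y in B x r) (f y)%:E)%E.
    apply: le_trans hr; rewrite lee_fin ler_wpM2r ?(ltW V0)//.
    rewrite /l mulrA mulrC [2 * _]mulrC divfK ?pnatr_eq0// mulrC.
    by rewrite ler_wpM2r ?powR_ge0.
  set G := (\int[mu]_(y in B x r) (f y `^ (v y)^-1)%:E)%E.
  have G0 : (0 <= G)%E by apply: integral_ge0 => y _; rewrite lee_fin powR_ge0.
  have GM : (G <= M%:E)%E.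
    apply: le_trans hM; apply: ge0_subset_integral => //.
    - exact: (rd_measurable_ball rd).
    - by apply/measurable_EFinP.
    - by move=> y _; rewrite lee_fin powR_ge0.
  have Gfin : G \is a fin_num by rewrite ge0_fin_numE// (le_lt_trans GM)// ltry.
  have hK y : B x r y -> l `^ (1 - (v y)^-1) <= K' * l `^ (1 - (v x)^-1).
    move=> By.
    have -> : 1 - (v y)^-1 = ((v x)^-1 - (v y)^-1) + (1 - (v x)^-1) by ring.
    rewrite powRD ?(gt_eqF l0) ?implybT// ler_wpM2r ?powR_ge0//.
    apply: powR_le_expR => //.
    case: tv => [t1|tv]; last by rewrite (tv x y) subrr mul0r.
    have dle := dist_inv_le a0 (va1 x) (va1 y).
    have [l1|l1] := leP 1 l.
      have lnl : 0 <= ln l by exact: ln_ge0.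
      apply: (@le_trans _ _ (a^-1 ^+ 2 * (ln K + K0))); last first.
        by rewrite lerDl mulr_ge0// invr_ge0 ltW.
      apply: (@le_trans _ _ (a^-1 ^+ 2 * `|v x - v y| * ln l)).
        by rewrite ler_wpM2r// (le_trans (ler_norm _)).
      rewrite -mulrA ler_wpM2l ?exprn_ge0 ?invr_ge0 ?(ltW a0)//.
      (* The growth condition on this very ball gives l <= K V^(-v(x)), so a large [l] occurs only
         on a ball of small volume. *)
      have lnle : ln l <= ln K - v x * ln (V x r).
        have : l * V x r <= K * V x r `^ (1 - v x).
          rewrite -lee_fin; apply: le_trans (grow x r r0); apply: le_trans lV.
          by rewrite lee_fin -mulrA ler_peMl ?ler1n// mulr_ge0 ?ltW.
        rewrite powRB ?(gt_eqF V0) ?implybT// powRr1 ?(ltW V0)//.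
        rewrite mulrCA [l * _]mulrC ler_pM2l// => h.
        have Kp : 0 < K := lt_le_trans ltr01 K1.
        rewrite -ln_powR -ln_div ?posrE ?powR_gt0//.
        by rewrite ler_ln ?posrE ?divr_gt0 ?powR_gt0.
      apply: le_trans (ler_wpM2l (normr_ge0 _) lnle) _.
      rewrite mulrDr lerD//; first by rewrite -[leRHS]mul1r ler_wpM2r.
      rewrite -mulrN mulrCA; apply: (@le_trans _ _ (v x * K0)).
        by rewrite ler_wpM2l ?(ltW (v0 x))// osc.
      by rewrite -[leRHS]mul1r ler_wpM2r.
    apply: (@le_trans _ _ (a^-1 * - ln (c / 2))); last first.
      rewrite lerDr mulr_ge0 ?addr_ge0 ?exprn_ge0 ?invr_ge0 ?(ltW a0)//.
    have lc : c / 2 <= l by rewrite /l ler_peMr ?(ltW c20)// t1w.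
    have lnl : ln (c / 2) <= ln l by rewrite ler_ln ?posrE.
    have lnl0 : ln l <= 0 by rewrite ln_le0// ltW.
    have p1 : (v y)^-1 <= a^-1 by rewrite lef_pV2 ?posrE.
    have p2 : 0 < (v x)^-1 by rewrite invr_gt0.
    have p3 : 0 < a^-1 by rewrite invr_gt0.
    by nra.
  have := ball_integral_le mf f0 mg (fun y => _) l0 (ltW K'0) hK (_ : (G <= (fine G)%:E)%E).
  rewrite fineK// => /(_ _ (lexx _)) hY.
  have {hY} hY : 2 * l * V x r <= l * V x r + K' * l `^ (1 - (v x)^-1) * fine G.
    rewrite -lee_fin; apply: le_trans lV _; apply: hY => y.
    by rewrite -[leLHS]invr1 lef_pV2 ?posrE.
  rewrite -[leRHS]fineK// lee_fin.
  have lp : 0 < l `^ (v x)^-1 by rewrite powR_gt0.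
  have {}hY : l `^ (v x)^-1 * V x r <= K' * fine G.
    have h : l * V x r <= K' * (l * l `^ (- (v x)^-1)) * fine G.
      move: hY; rewrite powRD ?(gt_eqF l0) ?implybT// powRr1 ?(ltW l0)//; lra.
    have := ler_wpM2l (ltW lp) h; rewrite powRN.
    have -> : l `^ (v x)^-1 * (K' * (l * (l `^ (v x)^-1)^-1) * fine G) =
       l * (K' * fine G) by field; rewrite gt_eqF.
    by rewrite mulrCA ler_pM2l.
  have lE : (c / 2) `^ a^-1 * t `^ (v x - eta)^-1 <= l `^ (v x)^-1.
    rewrite /l [leRHS]powRM ?powR_ge0 ?(ltW c20)//.
    have -> : (t `^ (v x / (v x - eta))) `^ (v x)^-1 = t `^ (v x - eta)^-1.
      by rewrite -powRrM; congr powR; field; rewrite !gt_eqF.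
    rewrite ler_wpM2r ?powR_ge0//; apply: ger_powR; first by rewrite c20.
    by rewrite lef_pV2 ?posrE.
  rewrite /kap [_ / K' * _]mulrAC [_ / K' * V x r]mulrAC ler_pdivrMr// [_ * K']mulrC.
  by apply: le_trans hY; rewrite ler_wpM2r// ltW.
- move=> x y r _ _ r0 By hV; rewrite mulrCA ler_pM2l//.
  have -> : (v y - eta)^-1 = ((v y - eta)^-1 - (v x - eta)^-1) + (v x - eta)^-1 by ring.
  rewrite powRD ?(gt_eqF t0) ?implybT// ler_wpM2r ?powR_ge0//.
  apply: powR_le_expR => //.
  case: tv => [t1|tv]; last by rewrite (tv x y) subrr mul0r.
  have V0 : 0 < V x r by exact: (ball_volume_gt0 rd).
  have lnt : 0 <= ln t by exact: ln_ge0.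
  have dle := dist_inv_le w0 (wx y) (wx x).
  apply: (@le_trans _ _ ((a - eta)^-1 ^+ 2 * `|v x - v y| * ln t)).
    rewrite ler_wpM2r// (le_trans (ler_norm _))// (le_trans dle)//.
    by rewrite (_ : v y - eta - (v x - eta) = v y - v x) 1?distrC//; ring.
  rewrite -mulrA ler_wpM2l ?exprn_ge0 ?invr_ge0 ?(ltW w0)//.
  (* Uses the smallness of [tau V] on the enlarged ball, together with 1/(v - eta) >= 1 and t >=
     1. *)
  have lnle : ln t <= ln (A * M / kap) - ln (V x r).
    apply: (@le_trans _ _ ((v x - eta)^-1 * ln t)).
      rewrite ler_peMl// -[leLHS]invr1 lef_pV2 ?posrE//.
      by have := v1 x; lra.
    have AMk : 0 < A * M / kap by exact: divr_gt0.
    rewrite -ln_powR -ln_div ?posrE// ler_ln ?posrE ?powR_gt0//; last exact: divr_gt0.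
    by rewrite ler_pdivlMr// ler_pdivlMr// mulrC mulrA.
  apply: le_trans (ler_wpM2l (normr_ge0 _) lnle) _.
  rewrite mulrDr lerD//; last exact: osc.
  apply: (@le_trans _ _ (1 * `|ln (A * M / kap)|)); last by rewrite mul1r.
  apply: (@le_trans _ _ (`|v x - v y| * `|ln (A * M / kap)|)).
    by rewrite ler_wpM2l// ler_norm.
  by rewrite ler_wpM2r.
Qed.

End WeakType.

(** * Change of exponent at infinity, and growth over balls *)

Section VariableExponent.
Context (R : realType) (d : measure_display) (X : measurableType d).
Variables (dist : X -> X -> R) (mu : {measure set X -> \bar R}).

Lemma measurable_powR_fun (f e : X -> R) : measurable_fun setT f ->
  measurable_fun setT e -> measurable_fun setT (fun y => f y `^ e y).
Proof.
move=> mf me; rewrite /powR; apply: measurable_fun_ifT.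
- by apply: measurable_fun_eqr => //; exact: measurable_cst.
- have -> : (fun x => (e x == 0)%:R) = (fun x => if e x == 0 then 1 else 0) :> (X -> R).
    by apply/funext => x; case: eqP.
  by apply: measurable_fun_ifT => //; apply: measurable_fun_eqr.
- apply: measurableT_comp => //; apply: measurable_funM => //.
  exact: measurableT_comp.
Qed.

(** Where b <= z^(-N) the error term suffices, as al >= 1. Elsewhere -ln b <= N ln z, which the
    decay of |al - be| compensates. It serves with z = e + d(x, x0). *)
Lemma powR_exponent_decay (b al be c z : R) N : 0 <= b <= 1 -> 1 <= al ->
  1 < z -> `|al - be| <= c / ln z -> be != 0 ->
  b `^ al <= expR (N%:R * c) * b `^ be + z ^- N.
Proof.
move=> /andP[b0 b1] al1 z1 hc be0.
have z0 : 0 < z := lt_trans ltr01 z1.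
have zN : 0 < z ^- N by rewrite invr_gt0 exprn_gt0.
have lnz : 0 < ln z by rewrite ln_gt0.
have [->|bN0] := eqVneq b 0.
  by rewrite !powR0// ?mulr0 ?add0r ?(ltW zN)// gt_eqF// (lt_le_trans ltr01).
have {}b0 : 0 < b by rewrite lt_neqAle eq_sym bN0.
have [bz|zb] := leP b (z ^- N).
  apply: (@le_trans _ _ b); last by rewrite (le_trans bz)// lerDr mulr_ge0 ?expR_ge0 ?powR_ge0.
  by apply: ge1r_powR; rewrite ?b0.
apply: (@le_trans _ _ (expR (N%:R * c) * b `^ be)); last by rewrite lerDl ltW.
rewrite -{1}(subrK be al) powRD ?bN0 ?implybT// ler_wpM2r ?powR_ge0//.
apply: powR_le_expR => //.
have lnb : - ln b <= N%:R * ln z.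
  rewrite mulr_natl -lnXn// -lnV ?posrE// ler_ln ?posrE ?invr_gt0 ?exprn_gt0//.
  by rewrite -[leRHS]invrK lef_pV2 ?posrE ?invr_gt0 ?exprn_gt0// ltW.
have lnb0 : 0 <= - ln b by rewrite oppr_ge0 ln_le0.
move: hc; rewrite ler_pdivlMr// => hc.
apply: (@le_trans _ _ (`|al - be| * - ln b)).
  rewrite -mulrNN ler_wpM2r// -normrN; exact: ler_norm.
apply: le_trans (ler_wpM2l (normr_ge0 _) lnb) _.
by rewrite mulrCA ler_wpM2l.
Qed.

Variables (A0 Cmu gamma : R).
Hypothesis rd : reverse_doubling_with dist mu A0 Cmu gamma.

Let B := qball dist.
Let V := ball_volume dist mu.

(** On the shell where e + d(x, x0) is about 2^n the integrand is about 2^(-nN) and the volume at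
    most Cmu^(n+1) V(x0, 1); taking 2^N >= 2 Cmu makes the series geometric. *)
Lemma decay_integrable (x0 : X) : exists N C,
  upper_integral_le mu (fun x => (expR 1 + dist x x0) ^- N) C.
Proof.
have C0 : 0 < Cmu := lt_le_trans ltr01 (rd_Cmu_ge1 rd).
have [N hN] := exp2_ge (2 * Cmu).
have e1 : 1 <= expR 1 :> R by rewrite -expR0 ler_expR.
have N0 : 0 < (2 : R) ^+ N by rewrite exprn_gt0.
have q1 : Cmu / 2 ^+ N < 1 by rewrite ltr_pdivrMr// mul1r; lra.
exists N, (Cmu * V x0 1 / (1 - Cmu / 2 ^+ N)).
apply: (upper_integral_le_geometric (D := fun n => B x0 (2 ^+ n.+1))
  (c := fun n => (2 ^- N) ^+ n) (f := cst 1)) => //.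
- by move=> n; exact: (rd_measurable_ball rd).
- by apply: mulr_ge0; [exact: ltW|exact: ball_volume_ge0].
- by rewrite q1 andbT divr_ge0// ltW.
- move=> n.
  have -> : (\int[mu]_(y in B x0 (2 ^+ n.+1)) ((cst 1 : X -> R) y)%:E =
      (V x0 (2 ^+ n.+1))%:E)%E.
    rewrite -(ball_volumeE rd) -[RHS]mul1e -integral_cst//.
    exact: (rd_measurable_ball rd).
  rewrite -EFinM lee_fin [leRHS](_ : _ = (2 ^- N) ^+ n * (Cmu ^+ n.+1 * V x0 1)).
    rewrite ler_wpM2l ?exprn_ge0 ?invr_ge0 ?(ltW N0)//.
    by apply: (ball_volume_doubling rd) => //; rewrite mulr1.
  by rewrite exprMn [Cmu ^+ n.+1]exprS; ring.
- move=> y; right.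
  have z1 : 1 <= expR 1 + dist y x0 by rewrite ler_wpDr// (rd_dist_ge0 rd).
  have [n /andP[h1 h2]] := dyadic_floor z1; exists n.
    rewrite /B/qball/= (rd_distC rd); apply: le_lt_trans h2.
    by rewrite lerDr (le_trans ler01).
  have -> : (2 ^- N) ^+ n * cst 1 y = ((2 : R) ^+ n) ^- N.
    by rewrite mulr1 exprVn -!exprM mulnC.
  rewrite lef_pV2 ?posrE ?exprn_gt0//; last by rewrite (lt_le_trans ltr01).
  by rewrite lerXn2r ?nnegrE ?exprn_ge0// (le_trans ler01).
Qed.

Variables (a eta : R).
Hypotheses (eta01 : 0 < eta < 1) (etaa : eta < a).

(** The level l = V^(-v(x)) balances [ball_integral_le]: both of its terms become multiples of V^(1
    - v(x)). *)
Lemma growth_of_modular (v f : X -> R) (K0 M : R) x r : 0 < r -> 0 <= K0 ->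
  (forall y, a <= v y <= 1) ->
  (forall y, dist x y < r -> `|v x - v y| * - ln (V x r) <= K0) ->
  V x r <= 1 \/ (forall y, v x = v y) ->
  measurable_fun setT f -> (forall y, 0 <= f y) ->
  measurable_fun setT (fun y => f y `^ (v y)^-1) ->
  (\int[mu]_y (f y `^ (v y)^-1)%:E <= M%:E)%E ->
  (\int[mu]_(y in B x r) (f y)%:E <=
    ((1 + expR (a^-1 ^+ 2 * K0) * M) * V x r `^ (1 - v x))%:E)%E.
Proof.
have /andP[eta0 eta1] := eta01.
move=> r0 K00 va osc Vv mf f0 mg hM.
have a0 : 0 < a := lt_trans eta0 etaa.
have va1 y : a <= v y by have /andP[] := va y.
have v0 y : 0 < v y := lt_le_trans a0 (va1 y).
have v1 y : v y <= 1 by have /andP[] := va y.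
have V0 : 0 < V x r by exact: (ball_volume_gt0 rd).
have l0 : 0 < V x r `^ (- v x) by rewrite powR_gt0.
have hK y : B x r y -> (V x r `^ (- v x)) `^ (1 - (v y)^-1) <=
    expR (a^-1 ^+ 2 * K0) * (V x r `^ (- v x)) `^ (1 - (v x)^-1).
  move=> By.
  have -> : 1 - (v y)^-1 = ((v x)^-1 - (v y)^-1) + (1 - (v x)^-1) by ring.
  rewrite powRD ?(gt_eqF l0) ?implybT// ler_wpM2r ?powR_ge0//.
  apply: powR_le_expR => //.
  have Q0 : 0 <= a^-1 ^+ 2 * K0 by rewrite mulr_ge0// exprn_ge0// invr_ge0 ltW.
  case: Vv => [V1|vE]; last by rewrite (vE y) subrr mul0r.
  have dle := dist_inv_le a0 (va1 x) (va1 y).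
  have lnV : 0 <= - ln (V x r) by rewrite oppr_ge0 ln_le0.
  rewrite ln_powR mulNr -mulrN.
  apply: (@le_trans _ _ (a^-1 ^+ 2 * `|v x - v y| * (v x * - ln (V x r)))).
    by rewrite ler_wpM2r ?mulr_ge0 ?(ltW (v0 x))// (le_trans (ler_norm _)).
  rewrite -mulrA ler_wpM2l ?exprn_ge0 ?invr_ge0 ?(ltW a0)// mulrCA.
  apply: (@le_trans _ _ (v x * K0)); first by rewrite ler_wpM2l ?(ltW (v0 x))// osc.
  by rewrite -[leRHS]mul1r ler_wpM2r.
have hB : (\int[mu]_(y in B x r) (f y `^ (v y)^-1)%:E <= M%:E)%E.
  apply: le_trans hM; apply: ge0_subset_integral => //.
  - exact: (rd_measurable_ball rd).
  - by apply/measurable_EFinP.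
  - by move=> y _; rewrite lee_fin powR_ge0.
apply: le_trans (ball_integral_le rd mf f0 mg _ l0 (expR_ge0 _) hK hB) _.
  by move=> y; rewrite -[leLHS]invr1 lef_pV2 ?posrE.
rewrite lee_fin le_eqVlt; apply/orP; left; apply/eqP.
have -> : (V x r `^ (- v x)) `^ (1 - (v x)^-1) = V x r `^ (1 - v x).
  by rewrite -powRrM; congr powR; field; rewrite gt_eqF.
have -> : V x r `^ (- v x) * V x r = V x r `^ (1 - v x).
  by rewrite -[X in _ * X]powRr1 ?(ltW V0)// -powRD ?(gt_eqF V0) ?implybT// addrC.
ring.
Qed.

End VariableExponent.

(** * Modular bound for the level sets at all heights *)

Section ModularBound.
Context (R : realType) (d : measure_display) (X : measurableType d).
Variables (dist : X -> X -> R) (mu : {measure set X -> \bar R}).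
Variables (A0 Cmu gamma : R).
Hypothesis rd : reverse_doubling_with dist mu A0 Cmu gamma.

Let B := qball dist.
Let V := ball_volume dist mu.

Lemma potential_exceedsD (eta : R) (f f1 f2 : X -> R) t x :
  (forall y, f y = f1 y + f2 y) ->
  potential_exceeds dist mu eta f t x ->
  potential_exceeds dist mu eta f1 (t / 2) x \/
  potential_exceeds dist mu eta f2 (t / 2) x.
Proof.
move=> fE ft; apply: contrapT => /not_orP[/contrapT h1 /contrapT h2].
apply: ft; apply: (upper_integral_leS _ _ (upper_integral_leD h1 h2)).
  by move=> y; rewrite fE mulrDl.
by rewrite -splitr.
Qed.

Lemma integral_le_upper (h h' : X -> R) c : (forall y, 0 <= h y) ->
  (forall y, h y <= h' y) -> upper_integral_le mu h' c ->
  (\int[mu]_y (h y)%:E <= c%:E)%E.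
Proof.
move=> h0 hh' hc; apply: le_trans (lee_abs _) (upper_integral_le_abse _ hc).
by move=> y; rewrite ger0_norm.
Qed.

Variables (a eta : R).
Hypotheses (eta01 : 0 < eta < 1) (etaa : eta < a).
Variables (x0 : X) (u : X -> R) (ui ci K0 : R).
Hypothesis mp : measurable_fun setT (fun x => (u x)^-1).
Hypothesis ua : forall x, a <= u x <= 1.
Hypothesis uia : a <= ui <= 1.
Hypothesis hui : forall x, `|u x - ui| <= ci / ln (expR 1 + dist x x0).
Hypothesis K00 : 0 <= K0.
Hypothesis osc : forall x y r, dist x y < r -> `|u x - u y| * - ln (V x r) <= K0.

Let large (f : X -> R) y : R := if 1 < f y then f y else 0.
Let small (f : X -> R) y : R := if 1 < f y then 0 else f y.

Let a0 : 0 < a.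
Proof. by have /andP[eta0 _] := eta01; exact: lt_trans etaa. Qed.
Let w0 : 0 < a - eta. Proof. by rewrite subr_gt0. Qed.
Let u0 x : 0 < u x. Proof. by have /andP[h _] := ua x; exact: lt_le_trans h. Qed.
Let ui0 : 0 < ui. Proof. by have /andP[h _] := uia; exact: lt_le_trans h. Qed.

Let inv_ge1 (v : R) : 0 < v -> v <= 1 -> 1 <= v^-1.
Proof. by move=> v0 v1; rewrite -[leLHS]invr1 lef_pV2 ?posrE. Qed.

Let p1 x : 1 <= (u x)^-1.
Proof. by apply: inv_ge1 => //; have /andP[] := ua x. Qed.
Let pi1 : 1 <= ui^-1.
Proof. by apply: inv_ge1 => //; have /andP[] := uia. Qed.

Let ltz x : 1 < expR 1 + dist x x0.
Proof.
apply: (@lt_le_trans _ _ (expR 1)); last by rewrite lerDl (rd_dist_ge0 rd).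
by rewrite -{1}expR0 ltr_expR.
Qed.

Let inv_decay x (v v' b : R) : 0 < b -> b <= v -> b <= v' ->
  `|v - v'| <= ci / ln (expR 1 + dist x x0) ->
  `|v^-1 - v'^-1| <= (b^-1 ^+ 2 * ci) / ln (expR 1 + dist x x0).
Proof.
move=> b0 bv bv' h; apply: (le_trans (dist_inv_le b0 bv bv')).
by rewrite -mulrA ler_wpM2l// exprn_ge0// invr_ge0 ltW.
Qed.

(** Where f <= 1, [powR_exponent_decay] exchanges the variable exponent for the limit one up to an
    integrable error. *)
Lemma small_part_modular : exists2 M, 1 <= M & forall f : X -> R,
  measurable_fun setT f -> (forall y, 0 <= f y) ->
  (\int[mu]_y (f y `^ (u y)^-1)%:E <= 1%:E)%E ->
  (\int[mu]_y (small f y `^ ui^-1)%:E <= M%:E)%E.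
Proof.
have [N [Ch hCh]] := decay_integrable rd x0.
pose k := expR (N%:R * (a^-1 ^+ 2 * ci)).
exists (1 + `|k * 1 + Ch|); first by rewrite lerDl.
move=> f mf f0 hf.
have hg : upper_integral_le mu (fun y => f y `^ (u y)^-1) 1.
  apply: upper_integral_le_measurable => //; last by move=> y; exact: powR_ge0.
  exact: measurable_powR_fun.
have := upper_integral_leD (upper_integral_leZ (expR_ge0 _ : 0 <= k) hg) hCh.
move=> /(upper_integral_leS (fun=> lexx _) (ler_norm _)).
move=> hh; apply: (@le_trans _ _ (`|k * 1 + Ch|%:E)); last by rewrite lee_fin lerDr.
apply: integral_le_upper hh => y; first exact: powR_ge0.
have /andP[uya _] := ua y; have /andP[uiia _] := uia.
have hd := inv_decay a0 uiia uya; rewrite distrC in hd.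
have s01 : 0 <= small f y <= 1.
  by rewrite /small; case: ltP => // h; rewrite ?lexx ?ler01// f0 h.
apply: le_trans (powR_exponent_decay N s01 pi1 (ltz y) (hd _ (hui y)) _) _.
  by rewrite gt_eqF// invr_gt0.
rewrite lerD2r ler_wpM2l ?expR_ge0// /small; case: ltP => // _.
by rewrite powR0 ?powR_ge0// gt_eqF// invr_gt0.
Qed.

Lemma modular_bound : exists C, forall (f : X -> R) t, 0 < t ->
  measurable_fun setT f -> (forall y, 0 <= f y) ->
  (\int[mu]_y (f y `^ (u y)^-1)%:E <= 1%:E)%E ->
  upper_integral_le mu (fun x => \1_(potential_exceeds dist mu eta f t) x *
    t `^ (u x - eta)^-1) C.
Proof.
have /andP[eta0 eta1] := eta01.
have [N [Ch hCh]] := decay_integrable rd x0.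
have [M M1 hM] := small_part_modular.
pose e1 := expR (a^-1 ^+ 2 * K0).
have e10 : 0 < e1 by exact: expR_gt0.
have M0 : 0 < M := lt_le_trans ltr01 M1.
have K1 : 1 <= 1 + e1 * M by rewrite lerDl mulr_ge0 ?ltW.
(* [Ca] is for the large part with exponent 1, [Cb] for the small part with the limit exponent, [Cc]
   for the large part with the variable exponent. *)
have [Ca hCa] := weak_type_of_growth rd eta01 etaa (lexx 0) (lexx 1) (lexx 1).
have [Cb hCb] := weak_type_of_growth rd eta01 etaa K00 K1 M1.
have K1' : 1 <= 1 + e1 * 1 by rewrite lerDl mulr_ge0 ?ltW.
have [Cc hCc] := weak_type_of_growth rd eta01 etaa K00 K1' (lexx 1).
have [c' c'0 pot] := potential_or_ball rd eta01 etaa K1.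
have a1 : a <= 1 by have /andP[/le_trans h /h] := uia.
have etaui : 0 < ui - eta.
  by rewrite subr_gt0; apply: lt_le_trans etaa _; have /andP[] := uia.
have ml f : measurable_fun setT f -> measurable_fun setT (large f).
  by move=> mf; apply: measurable_fun_ifT => //; exact: measurable_fun_ltr.
have ms f : measurable_fun setT f -> measurable_fun setT (small f).
  by move=> mf; apply: measurable_fun_ifT => //; exact: measurable_fun_ltr.
have l0 f : (forall y, 0 <= f y) -> forall y, 0 <= large f y.
  by move=> f0 y; rewrite /large; case: ifP.
have s0 f : (forall y, 0 <= f y) -> forall y, 0 <= small f y.
  by move=> f0 y; rewrite /small; case: ifP.
have lsE f y : f y = large f y + small f y.
  by rewrite /large /small; case: ifP; rewrite ?addr0 ?add0r.
have le_int (g h : X -> R) c : measurable_fun setT g -> measurable_fun setT h ->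
    (forall y, 0 <= g y) -> (forall y, g y <= h y) ->
    (\int[mu]_y (h y)%:E <= c%:E)%E -> (\int[mu]_y (g y)%:E <= c%:E)%E.
  move=> mg mh g0 gh; apply: le_trans; apply: ge0_le_lower_integral => y.
    by rewrite lee_fin.
  by rewrite lee_fin.
(* The price of halving t when [f] is split in two, uniform since q is at most 1/(a - eta). *)
pose D2 := (2 : R) `^ (a - eta)^-1.
have D20 : 0 < D2 by rewrite powR_gt0.
have half (b t : R) : 0 < t -> a - eta <= b -> t `^ b^-1 <= D2 * (t / 2) `^ b^-1.
  move=> t0 hb; have b0 := lt_le_trans w0 hb.
  have -> : t `^ b^-1 = 2 `^ b^-1 * (t / 2) `^ b^-1.
    by rewrite -powRM ?divr_ge0 ?(ltW t0)//; congr powR; field.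
  by rewrite ler_wpM2r ?powR_ge0// ler_powR ?ler1n// lef_pV2 ?posrE.
pose k := expR (N%:R * ((a - eta)^-1 ^+ 2 * ci)).
have k0 : 0 < k by exact: expR_gt0.
pose Cs := k * D2 * (Ca + Cb) + Ch.
have bsmall (f : X -> R) (t : R) : 0 < t -> t <= 1 ->
    measurable_fun setT f -> (forall y, 0 <= f y) ->
    (\int[mu]_y (f y `^ (u y)^-1)%:E <= 1%:E)%E ->
    upper_integral_le mu (fun x => \1_(potential_exceeds dist mu eta f t) x *
      t `^ (u x - eta)^-1) Cs.
  move=> t0 t1 mf f0 hf; have t20 : 0 < t / 2 by rewrite divr_gt0.
  have hA : upper_integral_le mu (fun x =>
      \1_(potential_exceeds dist mu eta (large f) (t / 2)) x *
      (t / 2) `^ (1 - eta)^-1) Ca.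
    have lp1 : (fun y => large f y `^ 1^-1) = large f.
      by apply/funext => y; rewrite invr1 powRr1// l0.
    have int1 : (\int[mu]_y (large f y)%:E <= 1%:E)%E.
      apply: le_int hf; [exact: ml|exact: measurable_powR_fun|exact: l0|].
      move=> y; rewrite /large; case: ltP => h; last exact: powR_ge0.
      by rewrite le1r_powR// ltW.
    apply: (hCa (fun=> 1)) => //.
    - by move=> x; rewrite a1 lexx.
    - by move=> x y r _; rewrite subrr normr0 mul0r.
    - by right.
    - exact: ml.
    - exact: l0.
    - by rewrite lp1; exact: ml.
    - by under eq_integral do rewrite invr1 powRr1 ?l0//.
    - move=> x r r0; rewrite subrr powRr0 mulr1; apply: le_trans int1.
      apply: ge0_subset_integral => //; first exact: (rd_measurable_ball rd).
        by apply/measurable_EFinP; exact: ml.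
      by move=> y _; rewrite lee_fin l0.
  have mspow : measurable_fun setT (fun y => small f y `^ ui^-1).
    by apply: measurable_powR_fun; [exact: ms|exact: measurable_cst].
  have hB : upper_integral_le mu (fun x =>
      \1_(potential_exceeds dist mu eta (small f) (t / 2)) x *
      (t / 2) `^ (ui - eta)^-1) Cb.
    apply: (hCb (fun=> ui)) => //.
    - by move=> x y r _; rewrite subrr normr0 mul0r.
    - by right.
    - exact: ms.
    - exact: s0.
    - exact: hM.
    - move=> x r r0; apply: (growth_of_modular rd eta01 etaa (v := fun=> ui)) => //.
      + by move=> y _; rewrite subrr normr0 mul0r.
      + by right.
      + exact: ms.
      + exact: s0.
      + exact: hM.
  have := upper_integral_leD (upper_integral_leZ
    (ltW (mulr_gt0 k0 D20)) (upper_integral_leD hA hB)) hCh.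
  apply: upper_integral_leS => // x; rewrite indicE.
  have zN : 0 <= (expR 1 + dist x x0) ^- N.
    by rewrite invr_ge0 exprn_ge0// (le_trans ler01)// ltW.
  case: (boolP (x \in _)) => [|_]; last first.
    rewrite mul0r addr_ge0// mulr_ge0 ?(ltW (mulr_gt0 k0 D20))//.
    by rewrite addr_ge0// mulr_ge0 ?powR_ge0.
  rewrite inE mul1r => /(potential_exceedsD (lsE f)) hx.
  have /andP[uxa ux1] := ua x; have /andP[uiia ui1] := uia.
  (* The decay lemma with b = t <= 1 replaces t^q(x) by its analogue with the limit exponent. *)
  apply: (@le_trans _ _ (k * t `^ (ui - eta)^-1 + (expR 1 + dist x x0) ^- N)).
    apply: powR_exponent_decay => //.
    - by rewrite t1 ltW.
    - by apply: inv_ge1; rewrite ?subr_gt0 ?(lt_le_trans etaa)//; lra.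
    - apply: inv_decay; first exact: w0.
      + by rewrite lerD2r.
      + by rewrite lerD2r.
      + by rewrite (_ : u x - eta - (ui - eta) = u x - ui)//; ring.
    - by rewrite gt_eqF// invr_gt0.
  rewrite lerD2r -mulrA ler_pM2l//.
  set SA := \1_(potential_exceeds _ _ _ (large f) _) x * _.
  set SB := \1_(potential_exceeds _ _ _ (small f) _) x * _.
  have SA0 : 0 <= SA by rewrite mulr_ge0 ?powR_ge0.
  have SB0 : 0 <= SB by rewrite mulr_ge0 ?powR_ge0.
  case: hx => hx.
  (* As t <= 1 and ui <= 1, the power with exponent 1/(ui - eta) is at most the one with exponent
     1/(1 - eta), which the large part controls. *)
  - have SAE : SA = (t / 2) `^ (1 - eta)^-1 by rewrite /SA indicE mem_set// mul1r.
    apply: (@le_trans _ _ (D2 * SA)); last by rewrite ler_pM2l// lerDl.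
    apply: (@le_trans _ _ (t `^ (1 - eta)^-1)); last by rewrite SAE half// lerD2r.
    apply: ger_powR; first by rewrite t0.
    by rewrite lef_pV2 ?posrE ?etaui ?subr_gt0// lerD2r.
  - have SBE : SB = (t / 2) `^ (ui - eta)^-1 by rewrite /SB indicE mem_set// mul1r.
    apply: (@le_trans _ _ (D2 * SB)); last by rewrite ler_pM2l// lerDr.
    by rewrite SBE half// lerD2r.
(* Above [t0] both t / 2 >= 1 and c' (t / 2) > 1, so the small part, with averages at most 1, cannot
   reach the level t / 2. *)
pose t0 := 1 + 2 * Num.max 1 c'^-1.
have blarge (f : X -> R) (t : R) : t0 < t ->
    measurable_fun setT f -> (forall y, 0 <= f y) ->
    (\int[mu]_y (f y `^ (u y)^-1)%:E <= 1%:E)%E ->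
    upper_integral_le mu (fun x => \1_(potential_exceeds dist mu eta f t) x *
      t `^ (u x - eta)^-1) (D2 * Cc).
  move=> tt0 mf f0 hf.
  have m1 : 1 <= Num.max 1 c'^-1 by rewrite le_max lexx.
  have mc : c'^-1 <= Num.max 1 c'^-1 by rewrite le_max lexx orbT.
  have t2 : 1 <= t / 2 by move: tt0; rewrite /t0; lra.
  have t2c : c'^-1 < t / 2 by move: tt0; rewrite /t0; lra.
  have tp : 0 < t by lra.
  have t20 : 0 < t / 2 by lra.
  have mlp : measurable_fun setT (fun y => large f y `^ (u y)^-1).
    by apply: measurable_powR_fun => //; exact: ml.
  have int1 : (\int[mu]_y (large f y)%:E <= 1%:E)%E.
    apply: le_int hf; [exact: ml|exact: measurable_powR_fun|exact: l0|].
    move=> y; rewrite /large; case: ltP => h; last exact: powR_ge0.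
    by rewrite le1r_powR// ltW.
  have intp : (\int[mu]_y (large f y `^ (u y)^-1)%:E <= 1%:E)%E.
    apply: le_int hf => //; [exact: measurable_powR_fun|by move=> y; exact: powR_ge0|].
    move=> y; rewrite /large; case: ltP => h//.
    by rewrite powR0 ?powR_ge0// gt_eqF// invr_gt0.
  have hC : upper_integral_le mu (fun x =>
      \1_(potential_exceeds dist mu eta (large f) (t / 2)) x *
      (t / 2) `^ (u x - eta)^-1) Cc.
    apply: hCc => //; first by left.
    - exact: ml.
    - exact: l0.
    - move=> x r r0; have [V1|V1] := leP (V x r) 1.
        apply: (growth_of_modular rd eta01 etaa (v := u)) => //.
        + by move=> y; exact: osc.
        + by left.
        + exact: ml.
        + exact: l0.
      (* On a ball of volume above 1 the total mass, at most 1, is already below V^(1 - u(x)). *)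
      apply: (@le_trans _ _ 1%:E).
        apply: le_trans int1.
        apply: ge0_subset_integral => //; first exact: (rd_measurable_ball rd).
          by apply/measurable_EFinP; exact: ml.
        by move=> y _; rewrite lee_fin l0.
      rewrite lee_fin mulr_ege1// -[leLHS](powRr0 (V x r)) ler_powR ?(ltW V1)//.
      by rewrite subr_ge0; have /andP[] := ua x.
  have nosmall x : ~ potential_exceeds dist mu eta (small f) (t / 2) x.
    move=> hx; case: (pot x ui (small f) (t / 2) uia t20) => [||r r0|//|[r r0]].
    - exact: ms.
    - exact: s0.
    - apply: (growth_of_modular rd eta01 etaa (v := fun=> ui)) => //.
      + by move=> y _; rewrite subrr normr0 mul0r.
      + by right.
      + exact: ms.
      + exact: s0.
      + by apply: measurable_powR_fun; [exact: ms|exact: measurable_cst].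
      + exact: hM.
    have : (\int[mu]_(y in B x r) (small f y)%:E <= (V x r)%:E)%E.
      rewrite -(ball_volumeE rd) -[leRHS]mul1e -integral_cst; last exact: (rd_measurable_ball rd).
      apply: ge0_le_integral => //.
      - exact: (rd_measurable_ball rd).
      - by move=> y _; rewrite lee_fin s0.
      - by apply: measurable_funTS; apply/measurable_EFinP; exact: ms.
      - by move=> y _; rewrite lee_fin /small; case: ltP.
    move=> h1 h2; have := le_trans h2 h1; rewrite lee_fin.
    have V0 : 0 < V x r by exact: (ball_volume_gt0 rd).
    rewrite -[leRHS]mul1r ler_pM2r//; apply/negP; rewrite -ltNge.
    rewrite -ltr_pdivrMl// mulr1; apply: (lt_le_trans t2c).
    apply: le1r_powR => //; rewrite ler_pdivlMr// mul1r; lra.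
  have := upper_integral_leZ (ltW D20) hC.
  apply: upper_integral_leS => // x; rewrite !indicE.
  case: (boolP (x \in _)) => [|_]; last first.
    by rewrite mul0r mulr_ge0 ?(ltW D20)// mulr_ge0 ?powR_ge0.
  rewrite inE => /(potential_exceedsD (lsE f))[hx|/nosmall//].
  by rewrite mem_set// !mul1r half// lerD2r; have /andP[] := ua x.
have t01 : 1 <= t0 by rewrite /t0 lerDl mulr_ge0// le_max ler01.
(* For 1 < t <= t0 the level set is contained in the one at height 1, and t^q(x) is at most this
   power of [t0]. *)
pose Cm := t0 `^ (a - eta)^-1 * Cs.
exists (Num.max Cs (Num.max Cm (D2 * Cc))) => f t tp mf f0 hf.
have [t1|t1] := leP t 1.
  apply: (upper_integral_leS (fun=> lexx _) _ (bsmall f t tp t1 mf f0 hf)).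
  by rewrite le_max lexx.
have [tt|tt] := leP t t0; last first.
  apply: (upper_integral_leS (fun=> lexx _) _ (blarge f t tt mf f0 hf)).
  by rewrite !le_max lexx !orbT.
have := upper_integral_leZ (powR_ge0 t0 (a - eta)^-1) (bsmall f 1 ltr01 (lexx 1) mf f0 hf).
apply: upper_integral_leS; last by rewrite !le_max lexx !orbT.
move=> x; rewrite powR1 !indicE.
case: (boolP (x \in _)) => [|_]; last by rewrite mul0r mulr_ge0 ?powR_ge0// mulr_ge0.
rewrite inE => hx; rewrite mem_set; last first.
  by move=> h; apply: hx; exact: upper_integral_leS (ltW t1) h.
have /andP[uxa _] := ua x.
have wx : a - eta <= u x - eta by rewrite lerD2r.
have wx0 := lt_le_trans w0 wx.
rewrite !mul1r mulr1; apply: (@le_trans _ _ (t `^ (a - eta)^-1)).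
  by rewrite ler_powR ?(ltW t1)// lef_pV2 ?posrE.
by apply: ge0_ler_powR; rewrite ?nnegrE ?invr_ge0 ?(ltW w0) ?(ltW tp)// (le_trans ler01).
Qed.

End ModularBound.

(** * Log-Hoelder conditions for 1/p and pointwise bounds *)

Section Exponents.
Context (R : realType) (d : measure_display) (X : measurableType d).
Variables (dist : X -> X -> R) (mu : {measure set X -> \bar R}).
Variables (A0 Cmu gamma : R).
Hypothesis rd : reverse_doubling_with dist mu A0 Cmu gamma.

Let ln_shift_gt0 x y : 0 < ln (expR 1 + dist x y).
Proof.
rewrite ln_gt0//; apply: (@lt_le_trans _ _ (expR 1)).
  by rewrite -{1}expR0 ltr_expR.
by rewrite lerDl (rd_dist_ge0 rd).
Qed.

Lemma clamp_dist_le (a b c r : R) : a <= b -> a <= c <= b ->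
  `|c - Num.max a (Num.min r b)| <= `|c - r|.
Proof.
move=> ab /andP[ac cb]; rewrite /Num.max /Num.min.
case: (ltP r b) => rb; case: ltP => h //.
- by rewrite !ger0_norm ?subr_ge0//; lra.
- by rewrite !ler0_norm ?subr_le0//; lra.
- by rewrite !ler0_norm ?subr_le0//; lra.
Qed.

Lemma LH_inv (x0 : X) (p : X -> R) : (forall x, 1 <= p x) -> LH dist x0 p ->
  LH dist x0 (fun x => 1 / p x).
Proof.
move=> p1 [[c0 h0] [ci [pi hi]]].
have inv1 (b c : R) : 1 <= b -> 1 <= c -> `|1 / b - 1 / c| <= `|b - c|.
  move=> b1 c1; rewrite !div1r; apply: le_trans (dist_inv_le ltr01 b1 c1) _.
  by rewrite invr1 expr1n mul1r.
split.
  exists c0 => x y xy dxy; apply: le_trans (h0 x y xy dxy); exact: inv1.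
exists ci, (1 / Num.max 1 pi) => x; apply: le_trans (hi x).
apply: le_trans (inv1 _ _ (p1 x) _) _; first by rewrite le_max lexx.
have := p1 x; rewrite /Num.max; case: ltP => h // px.
by rewrite !ger0_norm ?subr_ge0//; lra.
Qed.

Lemma LH_finite (x0 : X) (u : X -> R) : (mu setT < +oo)%E ->
  (forall x, 0 <= u x <= 1) -> LH0 dist u -> LH dist x0 u.
Proof.
move=> muoo u01 hu; split => //.
have [D D0 hD] := finite_measure_bounded rd muoo.
exists (ln (expR 1 + D)), 1 => x.
have e0 := expR_gt0 (1 : R).
apply: (@le_trans _ _ 1).
  by have /andP[? ?] := u01 x; rewrite ler_norml; apply/andP; split; lra.
rewrite ler_pdivlMr// mul1r ler_ln ?posrE ?lerD2l//.
all: by rewrite ltr_pwDl// (rd_dist_ge0 rd).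
Qed.

(** [LH0] forces continuity and balls have positive measure, so an almost everywhere bound holds at
    every point. It yields 1/p >= 1/p_+ pointwise. *)
Lemma LH0_ae_lower_bound (u : X -> R) a : LH0 dist u ->
  (\forall x \ae mu, a <= u x) -> forall x, a <= u x.
Proof.
move=> [c0 h0] [N [mN N0 hN]] x; rewrite leNgt; apply/negP => ux.
pose e := a - u x; have e0 : 0 < e by rewrite subr_gt0.
pose c := Num.max 0 c0; have cp : 0 <= c by rewrite le_max lexx.
(* Gives e s > c0, so within distance exp(-s) the function moves by less than [e]. *)
pose s := (c + 1) / e + 1; have s1 : 1 <= s.
  by rewrite lerDr; apply: divr_ge0; [exact: addr_ge0|exact: ltW].
pose r := expR (- s); have r0 : 0 < r by exact: expR_gt0.
have r2 : r < 1 / 2.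
  apply: (@le_lt_trans _ _ (expR (- 1))); first by rewrite ler_expR lerN2.
  rewrite expRN div1r ltf_pV2 ?posrE ?expR_gt0//.
  by apply: le_lt_trans (expR_gt1Dx (oner_neq0 R)).
have [y yr uy] : exists2 y, qball dist x r y & a <= u y.
  apply: contrapT => hn; have := rd_ball_gt0 rd x r0 => /andP[+ _].
  rewrite ltNge => /negP; apply; rewrite -N0; apply: le_measure.
  - by rewrite inE; exact: (rd_measurable_ball rd).
  - by rewrite inE.
  - by move=> y yr; apply: hN => /= uy; apply: hn; exists y.
have xy : x <> y by move=> xy; move: ux; rewrite xy ltNge uy.
have d0 : 0 < dist x y.
  rewrite lt_neqAle (rd_dist_ge0 rd) andbT eq_sym; apply/eqP.
  by move=> /(rd_dist_eq0 rd).
have lnd : s <= - ln (dist x y).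
  by rewrite lerNr -[leRHS]expRK ler_ln ?posrE ?expR_gt0// ltW.
have := h0 x y xy (lt_trans yr r2).
have -> : - c0 / ln (dist x y) = c0 / (- ln (dist x y)).
  by rewrite invrN mulrN mulNr.
apply/negP; rewrite -ltNge ltr_pdivrMr; last by rewrite (lt_le_trans _ lnd)// (lt_le_trans ltr01).
have eu : e <= `|u x - u y|.
  by rewrite distrC; apply: le_trans (ler_norm _); rewrite /e lerD2r.
have c0c : c0 <= c by rewrite le_max lexx orbT.
have es : e * s = c + 1 + e by rewrite /s; field; rewrite gt_eqF.
apply: (@lt_le_trans _ _ (e * s)); first by rewrite es; lra.
by apply: ler_pM => //; [exact: ltW|exact: le_trans s1].
Qed.

Lemma modular_finite (p f : X -> R) : modular mu (EFin \o p) f =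
  (\int[mu]_x (`|f x| `^ p x)%:E)%E.
Proof.
rewrite /modular.
have -> : exponent_infty (EFin \o p) = set0 :> set X.
  by rewrite -subset0 => x.
rewrite setC0 patch_set0.
have -> : EFin \o (fun=> 0) = cst 0%E :> (X -> \bar R) by [].
by rewrite Lnorm0// adde0.
Qed.

End Exponents.

(** * Normalisation and conclusion *)

Theorem theorem1p4 (R : realType) (d : measure_display) (X : measurableType d)
    (dist : X -> X -> R) (mu : {measure set X -> \bar R}) (x0 : X)
    (eta : R) (p q : X -> R) :
  reverse_doubling dist mu ->
  0 < eta < 1 ->
  measurable_fun setT p ->
  (forall x, 1 <= p x) ->
  ess_inf mu (EFin \o p) = 1%E ->
  (1 <= ess_sup mu (EFin \o p) < (1 / eta)%:E)%E ->
  (forall x, 1 / p x - 1 / q x = eta) ->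
  LH dist x0 p \/ ((mu setT < +oo)%E /\ LH0 dist (fun x => 1 / p x)) ->
  exists C : R, forall f : X -> R, var_Lebesgue mu (EFin \o p) f ->
    (weak_var_norm mu (EFin \o q) (frac_integral dist mu eta f)
       <= C%:E * var_norm mu (EFin \o p) f)%E.
Proof.
move=> hrd eta01 mp p1 _ /andP[sup1 supeta] hq hLH.
have [A0 [Cmu [gamma rd]]] := reverse_doubling_constants hrd.
have /andP[eta0 eta1] := eta01.
pose u x := 1 / p x.
have p0 x : 0 < p x := lt_le_trans ltr01 (p1 x).
have u1 x : 0 <= u x <= 1.
  by rewrite divr_ge0 ?(ltW (p0 x))//= ler_pdivrMr// mul1r.
have uLH : LH dist x0 u.
  case: hLH => [/(LH_inv p1)//|[muoo hu]]; exact: (LH_finite rd).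
have [P PE] : exists P, ess_sup mu (EFin \o p) = P%:E.
  by move: sup1 supeta; case: ess_sup => // P; exists P.
move: sup1 supeta; rewrite PE lee_fin lte_fin => P1 Peta.
have P0 : 0 < P := lt_le_trans ltr01 P1.
have etaa : eta < P^-1.
  by rewrite -[ltLHS]invrK ltf_pV2 ?posrE ?invr_gt0// -div1r.
have ua x : P^-1 <= u x <= 1.
  have /andP[_ ->] := u1 x; rewrite andbT.
  apply: (LH0_ae_lower_bound rd uLH.1).
  have /ess_supP : (ess_sup mu (EFin \o p) <= P%:E)%E by rewrite PE.
  apply: filterS => y /=; rewrite lee_fin => pP.
  by rewrite /u div1r lef_pV2 ?posrE.
have P1' : P^-1 <= 1 by rewrite invf_le1.
have [_ [ci [ri hri]]] := uLH.
(* The limit value is not known to lie in the range of admissible exponents; clamping it there does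
   not increase its distance to any u(x). *)
pose ui := Num.max P^-1 (Num.min ri 1).
have uia : P^-1 <= ui <= 1.
  by rewrite le_max lexx/= ge_max P1' ge_min lexx orbT.
have hui x : `|u x - ui| <= ci / ln (expR 1 + dist x x0).
  by apply: le_trans (hri x); exact: clamp_dist_le.
have [K0 K00 osc] := log_holder_oscillation rd u1 uLH.
have uV x : (u x)^-1 = p x by rewrite /u div1r invrK.
have mu_inv : measurable_fun setT (fun x => (u x)^-1).
  by rewrite (_ : (fun x => _) = p)//; apply/funext.
have [C0 hC0] := modular_bound rd eta01 etaa mu_inv ua uia hui K00 osc.
(* As q >= 1 and C >= 1, (1 / C)^q(x) <= 1 / C, so dividing the level by C absorbs [C0]. *)
pose C := Num.max 1 C0.
have C1 : 1 <= C by rewrite le_max lexx.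
have CC0 : C0 <= C by rewrite le_max lexx orbT.
have Cp : 0 < C := lt_le_trans ltr01 C1.
have qE x : q x = (u x - eta)^-1.
  by rewrite /u -(hq x) opprB addrCA subrr addr0 div1r invrK.
have q1 x : 1 <= q x.
  have /andP[uxa ux1] := ua x.
  rewrite qE -[leLHS]invr1 lef_pV2 ?posrE//; first by lra.
  by rewrite subr_gt0 (lt_le_trans etaa).
exists C => f [mf _].
apply: ge_ereal_sup => _ [t /= t0 <-].
(* For each [l] admissible in the norm of [f], it suffices that C l / t be admissible for the
   indicator of the level set. *)
rewrite -lee_pdivrMl//; apply/ereal_infP => _ [l [l0 hl] <-].
rewrite lee_pdivrMl// -EFinM -lee_pdivlMl// -EFinM.
apply: ereal_inf_lbound; exists (t^-1 * (C * l)) => //; split.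
  by rewrite !mulr_gt0// invr_gt0.
set E := [set x | _]; rewrite modular_finite.
pose g y := `|f y / l|.
have mg : measurable_fun setT g.
  by apply: measurableT_comp => //; apply: measurable_funM.
have hg : (\int[mu]_y (g y `^ (u y)^-1)%:E <= 1%:E)%E.
  rewrite modular_finite in hl; apply: le_trans hl.
  rewrite le_eqVlt; apply/orP; left; apply/eqP.
  by apply: eq_integral => y _; rewrite uV.
have tl0 : 0 < t / l by rewrite divr_gt0.
have g0 y : 0 <= g y by exact: normr_ge0.
have := hC0 g (t / l) tl0 mg g0 hg.
move=> /(upper_integral_leZ (ltW (_ : 0 < C^-1))); rewrite invr_gt0 => /(_ Cp) hh.
have {}hh := upper_integral_leS (fun=> lexx _) (_ : C^-1 * C0 <= 1) hh.
apply: integral_le_upper (hh _); last by rewrite ler_pdivrMl// mulr1.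
  by move=> y; exact: powR_ge0.
move=> x /=; rewrite [\1_E x]indicE; case: (boolP (x \in E)) => [|_]; last first.
  rewrite mul0r normr0 powR0 ?gt_eqF ?(lt_le_trans ltr01)//.
  by rewrite mulr_ge0 ?invr_ge0 ?(ltW Cp)// mulr_ge0 ?powR_ge0.
(* By contraposition: a bound t / l on the potential of |f| / l rescales to a bound t on |I
   f(x)|. *)
rewrite inE => Ex; have gx : potential_exceeds dist mu eta g (t / l) x.
  move=> /(upper_integral_leZ (ltW l0)) h.
  move: Ex; rewrite /E/= ltNge => /negP; apply.
  rewrite (_ : t = l * (t / l)); last by field; rewrite gt_eqF.
  apply: upper_integral_le_abse h => y.
  rewrite normrM normfV (ger0_norm (powR_ge0 _ _)) mulrA /g.
  by rewrite normrM normfV (gtr0_norm l0) [l * _]mulrC divfK// gt_eqF.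
rewrite indicE mem_set// !mul1r -qE.
have -> : (t^-1 * (C * l))^-1 = C^-1 * (t / l).
  by field; rewrite !gt_eqF.
rewrite gtr0_norm ?mulr_gt0 ?invr_gt0// [leLHS]powRM ?invr_ge0 ?(ltW Cp) ?(ltW tl0)//.
rewrite ler_wpM2r ?powR_ge0//; apply: ge1r_powR => //.
by rewrite invr_gt0 Cp invf_le1.
Qed.
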